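(* Let $q$ be a prime power. Let $\alpha\in\mathcal{T}_q$ be nonconstant of degree $d=[\mathbb{F}_q(T)(\alpha):\mathbb{F}_q(T)]$ and with minimal height $h(\alpha)=1/(q+1)$, and write $C_\alpha$ for the smooth proper algebraic curve over $\mathbb{F}_q$ whose function field is $\mathbb{F}_q(T)(\alpha)$. Then $$\#C_\alpha(\mathbb{F}_q)=d=n(q+1),$$ where $n$ is the gonality of $C_\alpha$. Moreover, $n$ is also equal to the number of algebraic conjugates $\beta$ of $\alpha$ with $\mathrm{ord}_0(\beta)>0$.
   Context: $\mathbb{F}_q(T)$ is the rational function field, $\overline{\mathbb{F}_q(T)}$ a fixed algebraic closure, and $\mathbb{F}_q((T))$ the field of formal Laurent series with its $T$-adic valuation $\mathrm{ord}_0$ (normalized by $\mathrm{ord}_0(T)=1$). The minimal polynomial of $\alpha\in\overline{\mathbb{F}_q(T)}$ is the unique polynomial $f\in\mathbb{F}_q[T][x]$ that is irreducible over $\mathbb{F}_q(T)$ as a polynomial in $x$, satisfies $f(\alpha)=0$, has coefficients in $\mathbb{F}_q[T]$ with no common factor, and whose leading coefficient (in $x$) is a monic polynomial in $T$. The height is $h(\alpha)=\deg_T(f)/\deg_x(f)$. An element $\alpha$ is totally $T$-adic if its minimal polynomial splits completely over $\mathbb{F}_q((T))$; $\mathcal{T}_q$ denotes the set of all totally $T$-adic elements of $\overline{\mathbb{F}_q(T)}$. The conjugates of $\alpha\in\mathcal{T}_q$ are the roots of $f$ in $\mathbb{F}_q((T))$. An element is constant if it is algebraic over $\mathbb{F}_q$,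 and nonconstant otherwise. The gonality of an algebraic curve $X/\mathbb{F}_q$ is the minimal degree of a nonconstant $\mathbb{F}_q$-morphism $X\to\mathbb{P}^1$. *)

(* Defs.v *)
From HB Require Import structures.
From mathcomp Require Import all_boot all_order all_algebra.
From mathcomp Require Import all_classical.
From mathcomp Require Import constructive_ereal.
From mathcomp Require Import ring lra zify.

Set Implicit Arguments.
Unset Strict Implicit.
Unset Printing Implicit Defensive.

Import Order.TTheory GRing.Theory Num.Theory.

Local Open Scope classical_set_scope.
Local Open Scope ring_scope.

(* sum_i (lcoef i) T^i, with finitely many terms of negative index *)
Record laurent (F : fieldType) := Laurent {
  lcoef : int -> F;
  lcoef_bounded : exists N : int, forall i : int, i < N -> lcoef i = 0 }.

Section LaurentField.
Variable F : fieldType.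
Local Notation laurent := (laurent F).
Implicit Types f g h : laurent.

HB.instance Definition _ := gen_eqMixin laurent.
HB.instance Definition _ := gen_choiceMixin laurent.

Lemma laurentP f g : lcoef f =1 lcoef g -> f = g.
Proof.
case: f g => [f hf] [g hg] /= /funext fg; rewrite {f}fg in hf *.
by congr Laurent; apply: Prop_irrelevance.
Qed.

Definition lbounded (N : int) f := forall i : int, i < N -> lcoef f i = 0.

Lemma lboundedW (M N : int) f : M <= N -> lbounded N f -> lbounded M f.
Proof. by move=> MN fN i iM; apply: fN; apply: lt_le_trans MN. Qed.

Lemma lboundedP f : exists N, lbounded N f.
Proof. exact: lcoef_bounded. Qed.

Lemma lbounded2 f g : exists N, lbounded N f /\ lbounded N g.
Proof.
have [N fN] := lboundedP f; have [M gM] := lboundedP g.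
by exists (Order.min N M); split; [apply: lboundedW fN|apply: lboundedW gM];
  rewrite ge_min lexx ?orbT.
Qed.

Lemma lzero_subproof : exists N : int, forall i : int, i < N -> (0 : F) = 0.
Proof. by exists 0. Qed.
Definition lzero := Laurent lzero_subproof.

Lemma lone_subproof :
  exists N : int, forall i : int, i < N -> ((i == 0)%:R : F) = 0.
Proof. by exists 0 => i; case: eqP => // ->. Qed.
Definition lone := Laurent lone_subproof.

Lemma lopp_subproof f :
  exists N : int, forall i : int, i < N -> - lcoef f i = 0.
Proof. by have [N fN] := lboundedP f; exists N => i /fN ->; rewrite oppr0. Qed.
Definition lopp f := Laurent (lopp_subproof f).

Lemma ladd_subproof f g :
  exists N : int, forall i : int, i < N -> lcoef f i + lcoef g i = 0.
Proof.
have [N [fN gN]] := lbounded2 f g; exists N => i iN.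
by rewrite fN // gN // addr0.
Qed.
Definition ladd f g := Laurent (ladd_subproof f g).

(* the summand has finite support, so this is the Cauchy product *)
Definition lconv f g (n : int) : F :=
  \sum_(i \in [set: int]) lcoef f i * lcoef g (n - i).

Lemma lconv_small N M f g : lbounded N f -> lbounded M g ->
  forall n, n < N + M -> lconv f g n = 0.
Proof.
move=> fN gM n nNM; apply: fsbig1 => i _.
have [/fN ->|Ni] := ltP i N; first by rewrite mul0r.
by rewrite gM ?mulr0 //; lia.
Qed.

Lemma lmul_subproof f g :
  exists N : int, forall i : int, i < N -> lconv f g i = 0.
Proof.
have [N [fN gN]] := lbounded2 f g.
by exists (N + N); apply: lconv_small.
Qed.
Definition lmul f g := Laurent (lmul_subproof f g).

Lemma lconvE N M f g (n : nat) : lbounded N f -> lbounded M g ->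
  lconv f g (N + M + n%:Z) =
  \sum_(j < n.+1) lcoef f (N + j%:Z) * lcoef g (M + (n - j)%N%:Z).
Proof.
move=> fN gM; pose r := [seq N + j%:Z | j <- iota 0 n.+1].
have r_uniq : uniq r by rewrite map_inj_uniq ?iota_uniq // => i j; lia.
rewrite /lconv (fsbigE r) //; last first.
  move=> i _ iNr; have [/fN ->|Ni] := ltP i N; first by rewrite mul0r.
  rewrite gM ?mulr0 //; apply: contraNT iNr; rewrite -leNgt => Mi.
  by apply/mapP; exists `|i - N|%N; rewrite ?mem_iota; lia.
under eq_bigl do rewrite in_setT.
rewrite big_map -[iota _ _]/(index_iota 0 n.+1) big_mkord.
by apply: eq_bigr => j _; congr (_ * lcoef g _); have := ltn_ord j; lia.
Qed.

Let tr m N f : {poly F} := \poly_(j < m) lcoef f (N + j%:Z).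

Let lmulE N M f g (m n : nat) : lbounded N f -> lbounded M g -> (n < m)%N ->
  lcoef (lmul f g) (N + M + n%:Z) = (tr m N f * tr m M g)`_n.
Proof.
move=> fN gM nm; rewrite /= lconvE // coefM; apply: eq_bigr => j _.
by rewrite !coef_poly !ifT //; have := ltn_ord j; lia.
Qed.

Let lmul_bounded N M f g : lbounded N f -> lbounded M g ->
  lbounded (N + M) (lmul f g).
Proof. exact: lconv_small. Qed.

Let laurent_eq N f g : lbounded N f -> lbounded N g ->
  (forall n : nat, lcoef f (N + n%:Z) = lcoef g (N + n%:Z)) -> f = g.
Proof.
move=> fN gN fg; apply: laurentP => i; have [iN|Ni] := ltP i N.
  by rewrite fN // gN.
by rewrite (_ : i = N + `|i - N|%N%:Z) ?fg //; lia.
Qed.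

Let coefM_eq (p p' q q' : {poly F}) n :
  (forall j, (j <= n)%N -> p`_j = p'`_j) ->
  (forall j, (j <= n)%N -> q`_j = q'`_j) ->
  (p * q)`_n = (p' * q')`_n.
Proof.
move=> pp qq; rewrite !coefM; apply: eq_bigr => j _.
by have := ltn_ord j; rewrite ltnS => ?; rewrite pp // qq // leq_subr.
Qed.

Let tr_mul N M f g m n : lbounded N f -> lbounded M g -> (n < m)%N ->
  (tr m (N + M) (lmul f g))`_n = (tr m N f * tr m M g)`_n.
Proof.
by move=> fN gM nm; rewrite coef_poly nm (lmulE fN gM nm).
Qed.

Lemma laddA : associative ladd.
Proof. by move=> f g h; apply: laurentP => i /=; rewrite addrA. Qed.
Lemma laddC : commutative ladd.
Proof. by move=> f g; apply: laurentP => i /=; rewrite addrC. Qed.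
Lemma ladd0l : left_id lzero ladd.
Proof. by move=> f; apply: laurentP => i /=; rewrite add0r. Qed.
Lemma laddNl : left_inverse lzero lopp ladd.
Proof. by move=> f; apply: laurentP => i /=; rewrite addNr. Qed.

HB.instance Definition _ := GRing.isZmodule.Build laurent
  laddA laddC ladd0l laddNl.

Lemma lmulA : associative lmul.
Proof.
move=> f g h; have [N fN] := lboundedP f; have [M gM] := lboundedP g.
have [P hP] := lboundedP h.
have fgB := lmul_bounded fN gM; have ghB := lmul_bounded gM hP.
apply: (@laurent_eq (N + M + P)).
- by rewrite -addrA; apply: lmul_bounded.
- exact: lmul_bounded.
move=> n; rewrite (lmulE fgB hP (ltnSn n)) -(addrA N M P) (lmulE fN ghB (ltnSn n)).
rewrite (coefM_eq (p' := tr n.+1 N f) (q' := tr n.+1 M g * tr n.+1 P h)) //.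
- rewrite mulrA; apply: coefM_eq => // j jn.
  by rewrite -tr_mul // ltnS.
- by move=> j jn; rewrite tr_mul // ltnS.
Qed.

Lemma lmulC : commutative lmul.
Proof.
move=> f g; have [N [fN gN]] := lbounded2 f g.
apply: (@laurent_eq (N + N)); try exact: lmul_bounded.
move=> n; rewrite (lmulE fN gN (ltnSn n)) (lmulE gN fN (ltnSn n)).
by rewrite mulrC.
Qed.

Lemma lmul1l : left_id lone lmul.
Proof.
move=> f; have [N fN] := lboundedP f.
have B1 : lbounded 0 lone by move=> i /=; case: eqP => // ->.
apply: (@laurent_eq (0 + N)); first exact: lmul_bounded.
  by rewrite add0r.
move=> n; rewrite /= lconvE // big_ord_recl /= mul1r subn0 add0r.
by rewrite big1 ?addr0 // => j _; rewrite mul0r.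
Qed.

Lemma lmulDl : left_distributive lmul ladd.
Proof.
move=> f g h; have [N [fN gN]] := lbounded2 f g; have [M hM] := lboundedP h.
have fgN : lbounded N (ladd f g) by move=> i iN /=; rewrite fN // gN // addr0.
apply: (@laurent_eq (N + M)); first exact: lmul_bounded.
  move=> i iN; change (lcoef (lmul f h) i + lcoef (lmul g h) i = 0).
  rewrite (lmul_bounded fN hM iN).
  by rewrite (lmul_bounded gN hM iN) addr0.
move=> n; rewrite /= !lconvE // -big_split /=.
by apply: eq_bigr => j _; rewrite mulrDl.
Qed.

Lemma lone_neq0 : lone != 0.
Proof.
by apply/eqP => /(congr1 (fun f : laurent => lcoef f 0)) /= /eqP; rewrite oner_eq0.
Qed.

HB.instance Definition _ := GRing.Zmodule_isComNzRing.Build laurent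
  lmulA lmulC lmul1l lmulDl lone_neq0.

Lemma lorder_exists f : f != 0 ->
  exists v : int, lcoef f v != 0 /\ lbounded v f.
Proof.
move=> f0; have [N fN] := lboundedP f.
have ex : exists n : nat, lcoef f (N + n%:Z) != 0.
  apply: contrapT => nex; move/negP: f0; apply; apply/eqP.
  apply: (@laurent_eq N) => // n.
  by apply/eqP; apply: contrapT => nn; apply: nex; exists n; apply/negP.
case: (ex_minnP ex) => n fn nmin; exists (N + n%:Z); split=> // i iN.
have [/fN //|Ni] := ltP i N; apply/eqP; apply: contraT => fi.
have := nmin `|i - N|%N; rewrite (_ : N + `|i - N|%N%:Z = i); last by lia.
by move=> /(_ fi); lia.
Qed.

Let inv_seq (a : nat -> F) := fix s (n : nat) : seq F :=
  if n is k.+1 then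
    rcons (s k) (((k == 0%N)%:R - \sum_(j < k) (s k)`_j * a (k - j)%N) / a 0%N)
  else [::].

Let inv_coef a n := (inv_seq a n.+1)`_n.

Let size_inv_seq a n : size (inv_seq a n) = n.
Proof. by elim: n => //= n IH; rewrite size_rcons IH. Qed.

Let inv_seqE a n j : (j < n)%N -> (inv_seq a n)`_j = inv_coef a j.
Proof.
elim: n => // n IH; rewrite ltnS leq_eqVlt => /orP[/eqP -> //|jn].
by rewrite /= nth_rcons size_inv_seq jn IH.
Qed.

Let inv_coefP a n : a 0%N != 0 ->
  \sum_(j < n.+1) inv_coef a j * a (n - j)%N = (n == 0%N)%:R.
Proof.
move=> a0; rewrite big_ord_recr /= subnn {2}/inv_coef /= nth_rcons.
rewrite size_inv_seq ltnn eqxx divfK //.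
rewrite [X in _ + (_ - X)](eq_bigr (fun j : 'I_n => inv_coef a j * a (n - j)%N)).
  by rewrite addrC subrK.
by move=> j _; rewrite inv_seqE.
Qed.

Lemma lmulV_exists f : f != 0 -> exists g, lmul g f = lone.
Proof.
move=> /lorder_exists[v [fv fB]].
pose a (n : nat) := lcoef f (v + n%:Z).
have a0 : a 0%N != 0 by rewrite /a addr0.
pose c (i : int) : F := if i < - v then 0 else inv_coef a (absz (i + v)).
have cB : exists N : int, forall i : int, i < N -> c i = 0.
  by exists (- v) => i; rewrite /c => ->.
pose g := Laurent cB; exists g.
have gB : lbounded (- v) g by move=> i /=; rewrite /c => ->.
apply: (@laurent_eq (- v + v)); first exact: lmul_bounded.
  by move=> i; rewrite addNr /=; case: eqP => // ->.
move=> n; rewrite /= lconvE // addNr add0r -[RHS](inv_coefP n a0).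
apply: eq_bigr => j _; rewrite /a /= /c ifF; last by lia.
by congr (inv_coef _ _ * _); lia.
Qed.

Definition linv f : laurent :=
  if pselect (exists g, lmul g f = lone) is left ex then projT1 (cid ex)
  else 0.

Lemma lmulVl f : f != 0 -> linv f * f = 1.
Proof.
move=> /lmulV_exists ex; rewrite /linv.
by case: pselect => // ex'; case: cid.
Qed.

Lemma linv0 : linv 0 = 0.
Proof.
rewrite /linv; case: pselect => // ex; case: (ex) => g gE.
by have := oner_neq0 laurent; rewrite -[1]gE -[lmul g 0]/(g * 0) mulr0 eqxx.
Qed.

HB.instance Definition _ := GRing.ComNzRing_isField.Build laurent lmulVl linv0.

Lemma laurent_of_poly_subproof (p : {poly F}) :
  exists N : int, forall i : int, i < N ->
    (if i is Posz n then p`_n else 0) = 0.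
Proof. by exists 0; case. Qed.
Definition laurent_of_poly p := Laurent (laurent_of_poly_subproof p).

Lemma laurent_of_poly_is_zmod : zmod_morphism laurent_of_poly.
Proof.
by move=> p q; apply: laurentP => -[n|n] /=; rewrite ?coefB // subr0.
Qed.
Lemma laurent_of_poly_is_monoid : monoid_morphism laurent_of_poly.
Proof.
have pB p : lbounded 0 (laurent_of_poly p) by case.
split=> [|p q]; first by apply: laurentP => -[n|n] //=; rewrite coef1.
apply: (@laurent_eq 0) => //.
  by rewrite -(addr0 0); apply: lmul_bounded.
move=> n; have /= -> := lconvE n (pB p) (pB q).
by rewrite coefM.
Qed.
HB.instance Definition _ := GRing.isZmodMorphism.Build {poly F} laurent
  laurent_of_poly laurent_of_poly_is_zmod.
HB.instance Definition _ := GRing.isMonoidMorphism.Build {poly F} laurent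
  laurent_of_poly laurent_of_poly_is_monoid.

End LaurentField.

(* T-adic order, with T_order 0 = +oo and T_order T = 1 *)
Definition T_order (F : fieldType) (f : laurent F) : \bar int :=
  if f == 0 then +oo%E
  else (xget 0 [set v : int | lcoef f v != 0 /\ lbounded v f])%:E.

Definition is_subfield (L : fieldType) (S : set L) : Prop :=
  divring_closed [in S].

(* [K : E] = n, for subfields E `<=` K of L: K has an E-basis of n elements *)
Definition extension_degree (L : fieldType) (E K : set L) (n : nat) : Prop :=
  exists b : 'I_n -> L, (forall i, K (b i)) /\
    forall x, K x -> exists! c : {ffun 'I_n -> L},
      (forall i, E (c i)) /\ x = \sum_(i < n) c i * b i.

Section TotallyTAdic.
Variables (F : finFieldType) (L : closedFieldType).
Variable iota : {rmorphism {fraction {poly F}} -> L}.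
Implicit Types (alpha : L) (f : {poly {poly F}}) (K : set L).

Definition const (c : F) : L := iota (tofrac c%:P).

Definition is_constant (x : L) : Prop := algebraicOver const x.

Definition over_rational f : {poly {fraction {poly F}}} :=
  map_poly (@tofrac {poly F}) f.

Definition is_minimal_polynomial alpha f : Prop :=
  [/\ irreducible_poly (over_rational f),
      root (map_poly iota (over_rational f)) alpha,
      (forall g : {poly F}, (forall i, g %| f`_i) -> size g = 1%N)
    & lead_coef f \is monic].

(* unique for algebraic alpha; 0 when alpha is transcendental *)
Definition minimal_polynomial alpha : {poly {poly F}} :=
  xget 0 [set f | is_minimal_polynomial alpha f].

(* deg_T / deg_x; sizeY is 1 + the largest degree in T of a coefficient *)
Definition height alpha : rat :=
  let f := minimal_polynomial alpha in
  (sizeY f).-1%:R / (size f).-1%:R.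

Definition over_laurent f : {poly laurent F} :=
  map_poly (@laurent_of_poly F) f.

Definition totally_T_adic : set L := [set alpha |
  let f := over_laurent (minimal_polynomial alpha) in
  exists rs : seq (laurent F),
    f = lead_coef f *: \prod_(r <- rs) ('X - r%:P)].

Definition conjugates alpha : set (laurent F) :=
  [set beta | root (over_laurent (minimal_polynomial alpha)) beta].

Definition rational_functions : set L := range iota.

Definition adjoin alpha : set L :=
  smallest (@is_subfield L) (rational_functions `|` [set alpha]).

(* The smooth proper curve C over F with function field K is taken to be the
   abstract nonsingular curve of K over F: its closed points are the valuation
   rings of K over F, i.e. the local rings of C at its closed points. *)
Definition closed_point K (O : set L) : Prop :=
  [/\ subring_closed [in O], range const `<=` O, O `<` K
    & forall x, K x -> O x \/ O x^-1].

Definition maximal_ideal (O : set L) : set L :=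
  [set x | O x /\ (x = 0 \/ ~ O x^-1)].

(* C(F): the closed points at which F is the whole residue field *)
Definition rational_points K : set (set L) := [set O |
  closed_point K O /\
  forall x, O x -> exists c : F, maximal_ideal O (x - const c)].

(* A nonconstant F-morphism C -> P^1 is given by its comorphism, an
   F-embedding of the function field F(t) of P^1 into K. *)
Definition nonconstant_morphism K
    (phi : {rmorphism {fraction {poly F}} -> L}) : Prop :=
  (forall c : F, phi (tofrac c%:P) = const c) /\ range phi `<=` K.

Definition morphism_degree K
    (phi : {rmorphism {fraction {poly F}} -> L}) (n : nat) : Prop :=
  extension_degree (range phi) K n.

Definition is_gonality K (n : nat) : Prop :=
  (exists phi, nonconstant_morphism K phi /\ morphism_degree K phi n) /\
  (forall phi m, nonconstant_morphism K phi -> morphism_degree K phi m ->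
    (n <= m)%N).

End TotallyTAdic.

(* Main.v *)
From HB Require Import structures.
Require Import Defs.
From mathcomp Require Import all_boot all_order all_algebra all_field.
From mathcomp Require Import all_classical.
From mathcomp Require Import constructive_ereal.
From mathcomp Require Import ring zify.

Set Implicit Arguments.
Unset Strict Implicit.
Unset Printing Implicit Defensive.

Import Order.TTheory GRing.Theory Num.Theory.
Local Open Scope classical_set_scope.
Local Open Scope ring_scope.

(** Let q be the cardinal of F, f the minimal polynomial of alpha, and m and D its
    degrees in T and in x, so that the height condition says D = m (q + 1). Let K be
    the field F(T)(alpha). The theorem follows from counting the rational points of
    K in two ways.

    Lower bound. The extension F((T)) / F(T) is separable, so that f, which splits
    over F((T)), has D distinct roots r there ([irreducible_roots_uniq]). Each root gives an embedding of K
    in F((T)), and the elements sent to power series form a valuation ring with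
    residue field F ([root_place_rational]). This ring determines r, because
    expansions in powers of T are computed inside it ([root_place_inj]). Hence K has
    at least D rational points.

    Upper bound. Let t be an element of K transcendental over F, and suppose that K
    is spanned by k elements over F(t). Rational points at which t has the same
    value in the projective line over F are separated by elements that are linearly
    independent over F(t) ([fibre_bound]), so there are at most k of them, and at
    most k (q + 1) rational points in all ([rational_points_bound]).

    Read as a polynomial in T, the relation f(T, alpha) = 0 shows that K is spanned
    over F(alpha) by m powers of T. The upper bound for t = alpha is then
    m (q + 1) = D. So K has exactly D rational points, one for each root of f, and
    every fibre of alpha has exactly m of them; the fibre of 0 consists of the roots
    of positive order. Finally, the upper bound applied to the parameter t of any
    morphism of degree k gives m (q + 1) <= k (q + 1), so m is the gonality
    ([gonality_of_rational_points]). *)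

(** * Fractions and simple extensions *)

Lemma fractionP (R : idomainType) (x : {fraction R}) :
  exists pq : R * R, pq.2 != 0 /\ x = tofrac pq.1 / tofrac pq.2.
Proof.
elim/quotW: x => x; exists (x.1, x.2); have x2 := denom_ratioP x.
split=> //; apply: (mulIf (x := tofrac x.2)); first by rewrite tofrac_eq0.
rewrite divfK ?tofrac_eq0 // /tofrac; unlock FracField.tofrac.
rewrite -[LHS]FracField.pi_mul; apply/eqmodP.
rewrite /= FracField.equivfE /FracField.mulf !numden_Ratio ?mulr1 ?oner_neq0 //.
by rewrite mulrC.
Qed.

Section FractionLift.
Variables (R : idomainType) (M : fieldType) (h : {rmorphism R -> M}).
Hypothesis h_inj : injective h.

Lemma fraction_lift : exists phi : {rmorphism {fraction R} -> M},
  forall p, phi (tofrac p) = h p.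
Proof.
pose nd x := sval (cid (@fractionP R x)).
have ndP x : (nd x).2 != 0 /\ x = tofrac (nd x).1 / tofrac (nd x).2.
  by rewrite /nd; case: cid.
have h0 q : q != 0 -> h q != 0 by rewrite -(inj_eq h_inj) rmorph0.
pose phi x := h (nd x).1 / h (nd x).2.
have phiE p q : q != 0 -> phi (tofrac p / tofrac q) = h p / h q.
  move=> q0; rewrite /phi; have [d0] := ndP (tofrac p / tofrac q).
  move/eqP; rewrite eqr_div ?tofrac_eq0 // -!tofracM tofrac_eq => /eqP e.
  by apply/eqP; rewrite eqr_div ?h0 // -!rmorphM e.
have phiB : zmod_morphism phi.
  move=> x y; have [[a b] /= [b0 ->]] := fractionP x.
  have [[c d] /= [d0 ->]] := fractionP y.
  rewrite -mulNr addf_div ?tofrac_eq0 // -!rmorphN -!rmorphM -rmorphD.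
  rewrite !phiE ?mulf_neq0 // rmorphD !rmorphM rmorphN -addf_div ?h0 //.
  by rewrite mulNr.
have phiM : monoid_morphism phi.
  split=> [|x y].
    by rewrite -(divr1 1) -tofrac1 phiE ?oner_neq0 // rmorph1 divr1.
  have [[a b] /= [b0 ->]] := fractionP x.
  have [[c d] /= [d0 ->]] := fractionP y.
  by rewrite mulf_div -!rmorphM !phiE ?mulf_neq0 // mulf_div !rmorphM.
pose phiA := GRing.isZmodMorphism.Build _ _ phi phiB.
pose phiMm := GRing.isMonoidMorphism.Build _ _ phi phiM.
pose phi' : {rmorphism {fraction R} -> M} := HB.pack phi phiA phiMm.
exists phi' => p; rewrite /= -(divr1 (tofrac p)) -tofrac1 phiE ?oner_neq0 //.
by rewrite rmorph1 divr1.
Qed.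

End FractionLift.

Lemma irreducible_neq0 (R : idomainType) (f : {poly R}) :
  irreducible_poly f -> f != 0.
Proof. by case=> f1 _; rewrite -size_poly_gt0; apply: ltnW. Qed.

Section SimpleExtension.
Variables (E M : fieldType) (phi : {rmorphism E -> M}) (x : M).
Local Notation ev g := (map_poly phi g).[x].

(** The part of p prime to g still vanishes at x, so a Bezout relation between
    it and g evaluates to u(x) g(x) = 1. *)
Lemma simple_extension_inv (p g : {poly E}) : p != 0 -> ev p = 0 -> ev g != 0 ->
  exists u, ev u * ev g = 1.
Proof.
move=> p0 px gx; pose p' := gdcop g p.
have p'x : ev p' = 0.
  apply/eqP; rewrite -/(root _ _) gdcop_map root_gdco ?map_poly_eq0 //.
  by rewrite !rootE px eqxx.
have /Bezout_eq1_coprimepP[[u v] /= uv] : coprimep p' g by apply: coprimep_gdco.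
exists v; move/(congr1 (fun q => ev q)): uv.
by rewrite rmorphD !rmorphM rmorph1 /= !hornerE p'x mulr0 add0r.
Qed.

Lemma simple_extension_span (p g : {poly E}) : p != 0 -> ev p = 0 ->
  exists c : 'I_(size p).-1 -> E, ev g = \sum_i phi (c i) * x ^+ i.
Proof.
move=> p0 px; exists (fun i => (g %% p)`_i).
have -> : ev g = ev (g %% p).
  by rewrite [in LHS](divp_eq g p) rmorphD rmorphM /= !hornerE px mulr0 add0r.
rewrite (@horner_coef_wide _ (size p).-1).
  by apply: eq_bigr => i _; rewrite coef_map.
by rewrite size_map_poly -ltnS prednK ?ltn_modp // size_poly_gt0.
Qed.

Lemma power_relation n (v : 'I_n -> E) i : v i != 0 ->
  \sum_j phi (v j) * x ^+ j = 0 ->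
  exists g : {poly E}, [/\ g != 0, (size g <= n)%N & ev g = 0].
Proof.
move=> vi vx; pose g := \poly_(j < n) (if insub j is Some j' then v j' else 0).
have gE (j : 'I_n) : g`_j = v j by rewrite coef_poly ltn_ord valK.
exists g; split; last 1 first.
- rewrite (@horner_coef_wide _ n) ?size_map_poly ?size_poly // -[RHS]vx.
  by apply: eq_bigr => j _; rewrite coef_map gE.
- by apply: contraNneq vi => g0; rewrite -gE g0 coef0.
exact: size_poly.
Qed.

Lemma irreducible_dvd_root (f g : {poly E}) : irreducible_poly f ->
  ev f = 0 -> ev g = 0 -> f %| g.
Proof.
move=> firr fx gx; apply: contraT; rewrite -irreducible_poly_coprime //.
move=> /Bezout_eq1_coprimepP[[u v] /= uv].
move/(congr1 (fun q => ev q)): uv.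
rewrite rmorphD !rmorphM rmorph1 /= !hornerE fx gx !mulr0 add0r => /eqP.
by rewrite eq_sym oner_eq0.
Qed.

End SimpleExtension.

(** The matrix of coefficients of the e i has more rows than columns, hence a
    nonzero left kernel. *)
Lemma linear_dependence (E M : fieldType) (phi : {rmorphism E -> M}) k r
    (b : 'I_k -> M) (e : 'I_r -> M) : (k < r)%N ->
  (forall i, exists c : 'I_k -> E, e i = \sum_j phi (c j) * b j) ->
  exists v : 'I_r -> E, (exists i, v i != 0) /\ \sum_i phi (v i) * e i = 0.
Proof.
move=> kr /choice[c eE]; pose A := \matrix_(i, j) c i j.
have : kermx A != 0.
  by rewrite kermx_eq0 /row_free neq_ltn (leq_ltn_trans (rank_leq_col A) kr).
case/rowV0Pn => v /sub_kermxP vA v0; exists (v 0); split.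
  by case/rV0Pn: v0 => i vi; exists i.
under eq_bigr do rewrite eE mulr_sumr.
rewrite exchange_big big1 //= => j _.
have := congr1 (fun w : 'rV_k => phi (w 0 j)) vA.
rewrite !mxE rmorph0 rmorph_sum => vAj.
transitivity ((\sum_i phi (v 0 i * A i j)) * b j); last by rewrite vAj mul0r.
rewrite mulr_suml; apply: eq_bigr => i _.
by rewrite mxE rmorphM mulrA.
Qed.

(** * Values at a rational point *)

Section Constants.
Variables (F : finFieldType) (L : closedFieldType).
Variable iota : {rmorphism {fraction {poly F}} -> L}.

HB.instance Definition _ := GRing.RMorphism.copy (const iota)
  (iota \o (@tofrac {poly F} \o polyC)).

End Constants.

Section Subfield.
Variables (L : fieldType) (K : set L).
Hypothesis subK : is_subfield K.

Lemma subfield1 : K 1.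
Proof. by case: subK => + _ _; rewrite inE. Qed.

Lemma subfieldB x y : K x -> K y -> K (x - y).
Proof. by case: subK => _ + _ Kx Ky => /(_ x y); rewrite !inE; apply. Qed.

Lemma subfield_div x y : K x -> K y -> K (x / y).
Proof. by case: subK => _ _ + Kx Ky => /(_ x y); rewrite !inE; apply. Qed.

Lemma subfield0 : K 0.
Proof. by rewrite -(subrr 1); apply: subfieldB; apply: subfield1. Qed.

Lemma subfieldD x y : K x -> K y -> K (x + y).
Proof.
move=> Kx Ky; rewrite -[y]opprK -[- y]add0r.
by do 2?apply: subfieldB => //; apply: subfield0.
Qed.

Lemma subfieldV x : K x -> K x^-1.
Proof. by move=> Kx; rewrite -div1r; apply: subfield_div => //; apply: subfield1. Qed.

Lemma subfieldM x y : K x -> K y -> K (x * y).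
Proof. by move=> Kx Ky; rewrite -[y]invrK; apply: subfield_div (subfieldV _). Qed.

Lemma subfieldX x n : K x -> K (x ^+ n).
Proof.
move=> Kx; elim: n => [|n IH]; first exact: subfield1.
by rewrite exprS; apply: subfieldM.
Qed.

Lemma subfield_horner (E : fieldType) (phi : {rmorphism E -> L}) g x :
  (forall c, K (phi c)) -> K x -> K (map_poly phi g).[x].
Proof.
move=> Kphi Kx; elim/poly_ind: g => [|g c IH].
  by rewrite rmorph0 horner0; apply: subfield0.
rewrite rmorphD rmorphM /= map_polyX map_polyC !hornerE.
by apply: subfieldD; [apply: subfieldM|apply: Kphi].
Qed.

End Subfield.

Section RationalPoint.
Variables (F : finFieldType) (L : closedFieldType).
Variable iota : {rmorphism {fraction {poly F}} -> L}.
Variables (K : set L) (subK : is_subfield K).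
Local Notation "c %:K" := (const iota c) (at level 1, format "c %:K").

Definition has_value (O : set L) (x : L) (c : F) := maximal_ideal O (x - c%:K).

Section OnePoint.
Variable O : set L.
Hypothesis OP : rational_points iota K O.

Lemma point1 : O 1.
Proof. by case: OP => -[[+ _ _] _ _ _] _; rewrite inE. Qed.

Lemma pointB x y : O x -> O y -> O (x - y).
Proof. by case: OP => -[[_ + _] _ _ _] _ Ox Oy => /(_ x y); rewrite !inE; apply. Qed.

Lemma pointM x y : O x -> O y -> O (x * y).
Proof. by case: OP => -[[_ _ +] _ _ _] _ Ox Oy => /(_ x y); rewrite !inE; apply. Qed.

Lemma point_const c : O c%:K.
Proof. by case: OP => -[_ + _ _] _; apply; exists c. Qed.

Lemma point_field x : O x -> K x.
Proof. by case: OP => -[_ _ [+ _] _] _; apply. Qed.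

Lemma point_or_inv x : K x -> O x \/ O x^-1.
Proof. by case: OP => -[_ _ _ +] _; apply. Qed.

Lemma point0 : O 0.
Proof. by rewrite -(subrr 1); apply: pointB; apply: point1. Qed.

Lemma pointN x : O x -> O (- x).
Proof. by rewrite -sub0r; apply: pointB; apply: point0. Qed.

Lemma pointD x y : O x -> O y -> O (x + y).
Proof. by move=> Ox Oy; rewrite -[y]opprK; apply/pointB/pointN. Qed.

Lemma ideal_point x : maximal_ideal O x -> O x.
Proof. by case. Qed.

Lemma ideal0 : maximal_ideal O 0.
Proof. by split; [apply: point0|left]. Qed.

Lemma idealM a x : O a -> maximal_ideal O x -> maximal_ideal O (a * x).
Proof.
move=> Oa [Ox xN]; split; first exact: pointM.
have [->|a0] := eqVneq a 0; first by left; rewrite mul0r.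
case: xN => [->|xN]; [by left; rewrite mulr0|right => axO; apply: xN].
by rewrite (_ : x^-1 = a * (a * x)^-1); [apply: pointM|rewrite invfM mulVKf].
Qed.

Lemma ideal1 : ~ maximal_ideal O 1.
Proof.
by move=> [_ []]; [apply/eqP; rewrite oner_eq0|rewrite invr1; case/(_ point1)].
Qed.

Lemma ideal_pole x : K x -> ~ O x -> maximal_ideal O x^-1.
Proof.
move=> Kx xN; have [//|xV] := point_or_inv Kx.
by split=> //; right; rewrite invrK.
Qed.

(** Of two elements of a valuation ring one divides the other. *)
Lemma idealD x y :
  maximal_ideal O x -> maximal_ideal O y -> maximal_ideal O (x + y).
Proof.
wlog Oxy : x y / O (x / y) => [hw mx my|mx my].
  have Kxy : K (x / y) by apply: subfield_div => //; apply/point_field/ideal_point.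
  have [Oxy|] := point_or_inv Kxy; first exact: hw.
  by rewrite invf_div addrC => Oyx; apply: hw.
have [y0|y0] := eqVneq y 0; first by rewrite y0 addr0.
rewrite (_ : x + y = (x / y + 1) * y); last by rewrite mulrDl divfK // mul1r.
by apply: idealM => //; apply: pointD => //; apply: point1.
Qed.

Lemma idealN x : maximal_ideal O x -> maximal_ideal O (- x).
Proof. by rewrite -mulN1r; apply/idealM/pointN/point1. Qed.

Lemma value_ideal x : has_value O x 0 <-> maximal_ideal O x.
Proof. by rewrite /has_value rmorph0 subr0. Qed.

Lemma value_point x c : has_value O x c -> O x.
Proof.
by move=> /ideal_point xc; rewrite -(subrK c%:K x); apply/pointD/point_const.
Qed.

Lemma value_exists x : O x -> exists c, has_value O x c.
Proof. by case: OP => _; apply. Qed.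

Lemma value_const c : has_value O c%:K c.
Proof. by rewrite /has_value subrr; apply: ideal0. Qed.

Lemma value1 : has_value O 1 1.
Proof. by rewrite -(rmorph1 (const iota)); apply: value_const. Qed.

Lemma valueD x y a b :
  has_value O x a -> has_value O y b -> has_value O (x + y) (a + b).
Proof.
by move=> xa yb; rewrite /has_value rmorphD opprD addrACA; apply: idealD.
Qed.

Lemma valueN x a : has_value O x a -> has_value O (- x) (- a).
Proof. by move=> xa; rewrite /has_value rmorphN -opprD; apply: idealN. Qed.

Lemma valueM x y a b :
  has_value O x a -> has_value O y b -> has_value O (x * y) (a * b).
Proof.
move=> xa yb; rewrite /has_value rmorphM.
rewrite (_ : _ - _ = y * (x - a%:K) + a%:K * (y - b%:K)); last by ring.
apply: idealD; apply: idealM => //; last exact: point_const.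
exact: value_point yb.
Qed.

(** If x had two values a and b, the unit a - b would lie in the maximal ideal. *)
Lemma value_unique x a b : has_value O x a -> has_value O x b -> a = b.
Proof.
move=> xa xb; apply/eqP; rewrite -subr_eq0; apply: contraT => ab.
have := valueD xa (valueN xb); rewrite subrr => e.
have := valueN (valueM e (value_const (a - b)^-1)).
rewrite mul0r mulfV // oppr0 => /(valueD value1).
by rewrite addr0 subrr => /value_ideal /ideal1.
Qed.

Lemma valueX x a n : has_value O x a -> has_value O (x ^+ n) (a ^+ n).
Proof.
move=> xa; elim: n => [|n IH]; first exact: value1.
by rewrite !exprS; apply: valueM.
Qed.

Lemma value_neq0 x a : a != 0 -> has_value O x a -> x != 0.
Proof.
move=> a0 xa; apply: contra_neq a0 => x0.
by apply: value_unique xa _; rewrite x0; apply/value_ideal/ideal0.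
Qed.

Lemma valueV x a : a != 0 -> has_value O x a -> has_value O x^-1 a^-1.
Proof.
move=> a0 xa; have x0 := value_neq0 a0 xa.
have Oxv : O x^-1.
  have [//|xN] := pselect (O x^-1); have [b xb] := value_exists (value_point xa).
  have : maximal_ideal O x by split; [exact: value_point xa|right].
  by move=> /value_ideal /(value_unique xa) a00; rewrite a00 eqxx in a0.
have [b xb] := value_exists Oxv.
have := valueM xa xb; rewrite mulfV // => /(value_unique value1) ab.
by rewrite (_ : a^-1 = b) // -[b](mulKf a0) -ab mulr1.
Qed.

Lemma value_horner (phi : {rmorphism {fraction {poly F}} -> L}) x a p :
  (forall c, phi (tofrac c%:P) = c%:K) -> phi (tofrac 'X) = x ->
  has_value O x a -> has_value O (phi (tofrac p)) p.[a].
Proof.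
move=> phic phiX xa; elim/poly_ind: p => [|p c IH].
  by rewrite !rmorph0 horner0; apply/value_ideal/ideal0.
rewrite !rmorphD !rmorphM /= phiX phic !hornerE.
by apply: valueD; [apply: valueM|apply: value_const].
Qed.

End OnePoint.
End RationalPoint.

(** * Rational points in a fibre *)

Section Fibre.
Variables (F : finFieldType) (L : closedFieldType).
Variable iota : {rmorphism {fraction {poly F}} -> L}.
Variables (K : set L) (subK : is_subfield K).
Local Notation "c %:K" := (const iota c) (at level 1, format "c %:K").
Local Notation rational := (rational_points iota K).
Local Notation value := (has_value iota).

(** Since c ^ q = c in F, the value of this function is 1 / (1 - c + c) = 1 at
    every rational point where z has a value c; at a pole of z the term z ^ q
    dominates and the value is 0. *)
Definition finite_indicator (z : L) : L := (1 - z + z ^+ #|F|)^-1.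

Lemma indicator_finite O z : rational O -> O z ->
  value O (finite_indicator z) 1.
Proof.
move=> OP Oz; have [c zc] := value_exists OP Oz.
rewrite -[X in value _ _ X]invr1; apply: (valueV subK OP); first exact: oner_neq0.
have := valueD subK OP (value1 OP) (valueN OP zc).
by move=> /(valueD subK OP)/(_ (valueX subK OP #|F| zc)); rewrite expf_card subrK.
Qed.

Lemma indicator_pole O z : rational O -> K z -> ~ O z ->
  value O (finite_indicator z) 0.
Proof.
move=> OP Kz zN; pose y := z^-1.
have y0 : value O y 0 by apply/value_ideal/(ideal_pole OP).
have z0 : z != 0 by apply/eqP => z0; apply: zN; rewrite z0; apply: (point0 OP).
(* #|F| > 1 makes the exponent of the subtracted power of y positive *)
have [q qE] : exists q, #|F| = q.+2.
  by have := finNzRing_gt1 F; case: #|F| => [|[|q]] // _; exists q.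
have yX n : value O (y ^+ n.+1) 0 
  by have := valueX subK OP n.+1 y0; rewrite expr0n.
have den1 : value O (1 - y ^+ q.+1 + y ^+ q.+2) 1.
  have := valueD subK OP (value1 OP) (valueN OP (yX q)).
  by move=> /(valueD subK OP)/(_ (yX q.+1)); rewrite oppr0 !addr0.
have -> : finite_indicator z = y ^+ q.+2 * (1 - y ^+ q.+1 + y ^+ q.+2)^-1.
  rewrite /finite_indicator qE /y -[in RHS](invrK (_ ^+ q.+2)) -invfM.
  congr _^-1; rewrite -exprVn invrK !exprVn mulrDr mulrBr mulr1.
  rewrite divff ?expf_neq0 // [z ^+ q.+2 in X in _ = _ - X + _]exprS.
  by rewrite mulfK ?expf_neq0 //; ring.
rewrite -(mul0r 1^-1); apply: (valueM subK OP) => //.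
by apply: (valueV subK OP) => //; apply: oner_neq0.
Qed.

(** A larger valuation ring has a smaller maximal ideal, and O' is generated by
    its maximal ideal and F. *)
Lemma rational_points_incomparable O O' : rational O -> rational O' ->
  O `<=` O' -> O = O'.
Proof.
move=> OP OP' OO'; apply/seteqP; split=> // x O'x.
have Kx := point_field OP' O'x; have [c xc] := value_exists OP' O'x.
rewrite -[x](subrK c%:K); apply: (pointD OP); last exact: (point_const OP).
have [//|xN] := pselect (O (x - c%:K)).
have : K (x - c%:K) by apply: (point_field OP'); apply: ideal_point xc.
move=> /(point_or_inv OP)[//|/OO' xV]; case: xc => _ [->|//].
exact: (point0 OP).
Qed.

(** For O' != O some z lies in O but not in O', and its indicator is 1 at O,
    0 at O' and finite at every other rational point. *)
Lemma separate_point (s : seq (set L)) O : rational O ->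
  (forall O', O' \in s -> rational O') ->
  exists e, [/\ K e, value O e 1 &
    forall O', O' \in s -> O' != O -> value O' e 0].
Proof.
move=> OP; suff H : (forall O', O' \in s -> rational O') ->
    exists e, [/\ K e, value O e 1, forall O', rational O' -> O' e &
      forall O', O' \in s -> O' != O -> value O' e 0].
  by move=> /H[e [Ke e1 _ e0]]; exists e.
elim: s => [_|O' s IH sP].
  exists 1; split=> //; first exact: subfield1.
    exact: value1 OP.
  by move=> O' OP'; apply: point1 OP'.
have [|e [Ke e1 eO e0]] := IH; first by move=> O1 O1s; apply: sP; rewrite inE O1s orbT.
have OP' : rational O' by apply: sP; rewrite mem_head.
have [OO'|OO'] := eqVneq O' O.
  exists e; split=> // O1; rewrite inE => /orP[/eqP ->|]; last exact: e0.
  by rewrite OO' eqxx.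
have [z [Oz zN]] : exists z, O z /\ ~ O' z.
  apply: contrapT => nz; move/eqP: OO'; apply; symmetry.
  apply: rational_points_incomparable => // x Ox.
  by apply: contrapT => xN; apply: nz; exists x.
have Kz := point_field OP Oz.
have indO O1 : rational O1 -> O1 (finite_indicator z).
  move=> O1P; have [zO1|zO1] := pselect (O1 z).
    exact: (value_point O1P (indicator_finite O1P zO1)).
  exact: (value_point O1P (indicator_pole O1P Kz zO1)).
exists (e * finite_indicator z); split.
- by apply: (point_field OP); apply: (pointM OP); [apply: eO|apply: indO].
- by have := valueM subK OP e1 (indicator_finite OP Oz); rewrite mulr1.
- by move=> O1 O1P; apply: (pointM O1P); [apply: eO|apply: indO].
move=> O1; rewrite inE => /orP[/eqP -> _|O1s O1O].
  have [c ec] := value_exists OP' (eO _ OP').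
  by rewrite -(mulr0 c); apply: (valueM subK OP') => //; apply: indicator_pole.
have O1P : rational O1 by apply: sP; rewrite inE O1s orbT.
have [c zc] := value_exists O1P (indO _ O1P).
by rewrite -(mul0r c); apply: (valueM subK O1P) => //; apply: e0.
Qed.

(** Reduction of t at O, as a point of the projective line over F; [None] is the
    point at infinity. *)
Definition reduces_to (O : set L) (t : L) (a : option F) : Prop :=
  if a is Some c then value O t c else ~ O t.

Section Morphism.
Variable phi : {rmorphism {fraction {poly F}} -> L}.
Hypothesis phi_const : forall c, phi (tofrac c%:P) = c%:K.
Hypothesis phi_K : forall x, K (phi x).
Local Notation t := (phi (tofrac 'X)).

Let phi_eq0 p : (phi (tofrac p) == 0) = (p == 0).
Proof. by rewrite fmorph_eq0 tofrac_eq0. Qed.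

(** At a pole of t, p(t) / t ^ n is a polynomial in 1 / t with constant
    coefficient p`_n. *)
Lemma value_reverse O n (p : {poly F}) : rational O -> ~ O t ->
  (size p <= n.+1)%N -> value O (phi (tofrac p) * t^-1 ^+ n) p`_n.
Proof.
move=> OP tN; have t0 : t != 0 by rewrite phi_eq0 polyX_eq0.
have tV : value O t^-1 0 by apply/value_ideal/(ideal_pole OP).
have tVn m : value O (t^-1 ^+ m.+1) 0.
  by have := valueX subK OP m.+1 tV; rewrite expr0n.
elim/poly_ind: p n => [|p c IH] n pn.
  by rewrite !rmorph0 mul0r coef0; apply/value_ideal/(ideal0 OP).
rewrite rmorphD rmorphM /= rmorphD rmorphM phi_const.
have [p0|p0] := eqVneq p 0.
  rewrite p0 !rmorph0 !mul0r !add0r coefC; case: n {pn} => [|n].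
    by rewrite expr0 mulr1; apply: (value_const OP).
  by have := valueM subK OP (value_const OP c) (tVn n); rewrite mulr0.
case: n pn => [|n]; rewrite size_MXaddC (negPf p0) /= ltnS => pn.
  by move: pn; rewrite leqn0 size_poly_eq0 (negPf p0).
rewrite coefD coefMX coefC /= mulrDl; apply: (valueD subK OP).
  by rewrite exprS mulrA mulfK //; apply: IH.
by have := valueM subK OP (value_const OP c) (tVn n); rewrite mulr0.
Qed.

(** The local parameter u is t - c at a finite point c and 1 / t at infinity: all
    the zeros and poles at a of a rational function of t are in a power of u. *)
Lemma local_parameter a : exists2 u : L, u != 0 &
  (forall O, rational O -> reduces_to O t a -> value O u 0) /\
  forall x, x != 0 -> exists k w, phi x = u ^ (k : int) * w /\
    forall O, rational O -> reduces_to O t a -> exists2 c, c != 0 & value O w c.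
Proof.
suff [u u0 [uO uP]] : exists2 u : L, u != 0 &
    (forall O, rational O -> reduces_to O t a -> value O u 0) /\
    forall p, p != 0 -> exists k w, phi (tofrac p) = u ^ (k : int) * w /\
      forall O, rational O -> reduces_to O t a -> exists2 c, c != 0 & value O w c.
  exists u => //; split=> // x; have [[p q] /= [q0 ->]] := fractionP x.
  rewrite mulf_eq0 invr_eq0 !tofrac_eq0 (negPf q0) orbF => p0.
  have [k [w [pE wP]]] := uP p p0; have [l [v [qE vP]]] := uP q q0.
  exists (k - l), (w / v); split.
    by rewrite fmorph_div /= pE qE expfzDr // invfM invr_expz mulrACA.
  move=> O OP Oa; have [c c0 wc] := wP O OP Oa; have [d d0 vd] := vP O OP Oa.
  exists (c / d); first by rewrite mulf_neq0 ?invr_neq0.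
  by apply: (valueM subK OP) => //; apply: (valueV subK OP).
case: a => [c|] /=.
  exists (phi (tofrac ('X - c%:P))); first by rewrite phi_eq0 polyXsubC_eq0.
  split=> [O OP tc|p p0].
    have := value_horner subK OP ('X - c%:P) phi_const (erefl _) tc.
    by rewrite !hornerE subrr.
  have [m [p1 /implyP/(_ p0) p1c ->]] := multiplicity_XsubC p c.
  exists m%:Z, (phi (tofrac p1)); split; first by rewrite !rmorphM !rmorphXn mulrC.
  by move=> O OP tc; exists p1.[c] => //; apply: (value_horner subK OP).
have t0 : t != 0 by rewrite phi_eq0 polyX_eq0.
exists t^-1; rewrite ?invr_neq0 //; split=> [O OP tN|p p0].
  by apply/value_ideal/(ideal_pole OP).
exists (- (size p).-1%:Z), (phi (tofrac p) * t^-1 ^+ (size p).-1); split.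
  by rewrite -exprnN mulrC mulfK // expf_neq0 // invr_neq0.
move=> O OP tN; exists (lead_coef p); first by rewrite lead_coef_eq0.
by apply: value_reverse => //; apply: leqSpred.
Qed.

Lemma value_sum O (I : Type) (r : seq I) (P : pred I) (f : I -> L) (c : I -> F) :
  rational O -> (forall i, P i -> value O (f i) (c i)) ->
  value O (\sum_(i <- r | P i) f i) (\sum_(i <- r | P i) c i).
Proof.
move=> OP fc; apply: (big_rec2 (fun x a => value O x a)) => [|i a x Pi xa].
  by apply/value_ideal/(ideal0 OP).
by apply: (valueD subK OP) => //; apply: fc.
Qed.

(** Elements that separate the points of a fibre of t are linearly independent
    over F(t): after division by the smallest power of the local parameter, a
    dependence has regular coefficients, one of which does not vanish at the
    point that its term separates. *)
Lemma fibre_bound k (b : 'I_k -> L) (a : option F) (s : seq (set L)) :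
  (forall x, K x -> exists c : 'I_k -> {fraction {poly F}},
     x = \sum_j phi (c j) * b j) ->
  uniq s -> (forall O, O \in s -> rational O /\ reduces_to O t a) ->
  (size s <= k)%N.
Proof.
move=> span s_uniq sP; rewrite leqNgt; apply/negP => ks.
pose O (i : 'I_(size s)) := nth set0 s i.
have Os i : O i \in s by apply: mem_nth.
have OP i : rational (O i) by have [] := sP _ (Os i).
have Oa i : reduces_to (O i) t a by have [] := sP _ (Os i).
have O_neq i j : j != i -> O j != O i by rewrite /O nth_uniq.
have /choice[e eP] : forall i, exists e, [/\ K e, value (O i) e 1 &
    forall O', O' \in s -> O' != O i -> value O' e 0].
  by move=> i; apply: separate_point => // O' /sP[].
have [|v [[i1 vi1] ve0]] := linear_dependence (phi := phi) (b := b) (e := e) ks.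
  by move=> i; apply: span; case: (eP i).
have [u u0 [uO uP]] := local_parameter a.
have /choice[kw kwP] : forall i, exists kw : int * L, v i != 0 ->
    phi (v i) = u ^ kw.1 * kw.2 /\ forall O, rational O -> reduces_to O t a ->
      exists2 c, c != 0 & value O kw.2 c.
  move=> i; have [->|/uP[k' [w H]]] := eqVneq (v i) 0; last by exists (k', w).
  by exists (0, 0).
pose i0 := [arg min_(i < i1 | v i != 0) (kw i).1]%O.
have [vi0 k0] : v i0 != 0 /\ forall i, v i != 0 -> (kw i0).1 <= (kw i).1.
  by rewrite /i0; case: arg_minP.
pose f i := phi (v i) * u ^ (- (kw i0).1) * e i.
have f0 : \sum_i f i = 0.
  transitivity (u ^ (- (kw i0).1) * \sum_i phi (v i) * e i).
    by rewrite mulr_sumr; apply: eq_bigr => i _; rewrite mulrA [u ^ _ * _]mulrC.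
  by rewrite ve0 mulr0.
have fi0 i : i != i0 -> value (O i0) (f i) 0.
  move=> ii0; have [vi|vi] := eqVneq (v i) 0.
    by rewrite /f vi rmorph0 !mul0r; apply/value_ideal/(ideal0 (OP i0)).
  have [viE wP] := kwP i vi; have [c _ wc] := wP _ (OP i0) (Oa i0).
  have ei : value (O i0) (e i) 0.
    by have [_ _] := eP i; apply=> //; apply: O_neq; rewrite eq_sym.
  rewrite /f viE [X in X * e i]mulrAC -expfzDr //.
  have [n ->] : exists n : nat, (kw i).1 - (kw i0).1 = n.
    by exists `|(kw i).1 - (kw i0).1|%N; have := k0 _ vi; lia.
  rewrite -(mulr0 (0 ^+ n * c)); apply: (valueM subK (OP i0)) => //.
  apply: (valueM subK (OP i0)) => //; apply: (valueX subK (OP i0)).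
  exact: uO.
have [vi0E wP] := kwP i0 vi0; have [c c0 wc] := wP _ (OP i0) (Oa i0).
have fi0c : value (O i0) (f i0) c.
  rewrite /f vi0E [X in X * e i0]mulrAC -expfzDr // subrr expr0z mul1r.
  by rewrite -[c]mulr1; apply: (valueM subK (OP i0)) => //; case: (eP i0).
have := value_sum (index_enum _) (OP i0) fi0.
move=> /(valueD subK (OP i0) fi0c).
move: f0; rewrite (bigD1 i0) //= => ->.
rewrite big1_eq addr0 => /(value_unique subK (OP i0)) c00.
move: c0; rewrite (c00 0) ?eqxx //; apply/value_ideal/(ideal0 (OP i0)).
Qed.

End Morphism.
End Fibre.

(** * Counting rational points *)

Lemma pigeonhole_eq (T : eqType) (A : finType) (r : T -> A) k (s : seq T) :
  (forall a, count (fun x => r x == a) s <= k)%N ->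
  (size s <= k * #|A| ?= iff [forall a, count (fun x => r x == a) s == k])%N.
Proof.
move=> rk; have -> : size s = (\sum_a count (fun x => r x == a) s)%N.
  rewrite -sum1_size (partition_big r xpredT) //=.
  by apply: eq_bigr => a _; rewrite sum1_count.
rewrite mulnC -sum_nat_const.
by apply: (leqif_sum (P := xpredT)) => a _; apply/leqif_eq/rk.
Qed.

Section Counting.
Variables (F : finFieldType) (L : closedFieldType).
Variable iota : {rmorphism {fraction {poly F}} -> L}.
Variables (K : set L) (subK : is_subfield K).
Local Notation rational := (rational_points iota K).

Variable phi : {rmorphism {fraction {poly F}} -> L}.
Hypothesis phi_morphism : nonconstant_morphism iota K phi.
Local Notation t := (phi (tofrac 'X)).

Definition reduction (O : set L) : option F :=
  [pick c | `[< has_value iota O t c >]].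

Lemma reductionP O : rational O -> reduces_to iota O t (reduction O).
Proof.
move=> OP; rewrite /reduction; case: pickP => [c /asboolP //|nc] /= Ot.
by have [c tc] := value_exists OP Ot; have /asboolP := nc c.
Qed.

Lemma reduction_unique O a : rational O -> reduces_to iota O t a -> reduction O = a.
Proof.
move=> OP; have := reductionP OP; case: (reduction O) a => [c|] [d|] //=.
- by move=> tc td; rewrite (value_unique subK OP tc td).
- by move=> /(value_point OP).
- by move=> tN /(value_point OP).
Qed.

Definition spanned_by k := exists b : 'I_k -> L,
  forall x, K x -> exists c : 'I_k -> {fraction {poly F}},
    x = \sum_j phi (c j) * b j.

Lemma degree_spanned k : morphism_degree K phi k -> spanned_by k.
Proof.
move=> [b [_ bP]]; exists b => x /bP[c [[cphi ->] _]].
have /choice[c' cE] : forall i, exists z, c i = phi z.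
  by move=> i; case: (cphi i) => z _ <-; exists z.
by exists c'; apply: eq_bigr => i _; rewrite cE.
Qed.

(** The fibres of t over the q + 1 points of the projective line over F have at
    most k points each. *)
Lemma rational_points_bound k (s : seq (set L)) : spanned_by k ->
  uniq s -> (forall O, O \in s -> rational O) ->
  (size s <= k * (#|F| + 1) ?= iff
    [forall a, count (fun O => reduction O == a) s == k])%N.
Proof.
move=> [b span] s_uniq sP; rewrite addn1 -card_option.
apply: pigeonhole_eq => a; rewrite -size_filter.
case: phi_morphism => phic phiK.
apply: (fibre_bound subK phic _ span (a := a)).
- by move=> x; apply: phiK; exists x.
- exact: filter_uniq.
move=> O; rewrite mem_filter => /andP[/eqP <- /sP OP].
by split=> //; apply: reductionP.
Qed.

End Counting.

(** * The function field as a simple extension *)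

Lemma simple_extension_subfield (E M : fieldType) (phi : {rmorphism E -> M}) x
    (p : {poly E}) : p != 0 -> (map_poly phi p).[x] = 0 ->
  is_subfield [set y | exists g, y = (map_poly phi g).[x]].
Proof.
move=> p0 px; split=> [|y z|y z]; rewrite !inE /=.
- by exists 1; rewrite rmorph1 hornerC.
- by move=> [g ->] [h ->]; exists (g - h); rewrite rmorphB hornerD hornerN.
move=> [g ->] [h ->]; have [h0|h0] := eqVneq (map_poly phi h).[x] 0.
  by exists 0; rewrite h0 invr0 mulr0 rmorph0 horner0.
have [u uh] := simple_extension_inv p0 px h0.
exists (g * u); rewrite rmorphM hornerM; congr (_ * _).
by apply: (mulIf h0); rewrite mulVf.
Qed.

Section Adjoin.
Variables (F : finFieldType) (L : closedFieldType).
Variable iota : {rmorphism {fraction {poly F}} -> L}.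
Variable alpha : L.
Local Notation K := (adjoin iota alpha).

Lemma adjoin_subfield : is_subfield K.
Proof.
split=> [|x y|x y]; rewrite !inE.
- by move=> M [MP _]; apply: subfield1.
- by move=> Kx Ky M MP; apply: subfieldB; [case: MP|apply: Kx|apply: Ky].
- by move=> Kx Ky M MP; apply: subfield_div; [case: MP|apply: Kx|apply: Ky].
Qed.

Lemma adjoin_rational x : K (iota x).
Proof. by move=> M [_]; apply; left; exists x. Qed.

Lemma adjoin_generator : K alpha.
Proof. by move=> M [_]; apply; right. Qed.

Lemma adjoin_simple p : p != 0 -> (map_poly iota p).[alpha] = 0 ->
  forall x, K x -> exists g, x = (map_poly iota g).[alpha].
Proof.
move=> p0 pa x /(_ [set y | exists g, y = (map_poly iota g).[alpha]]); apply.
split; first exact: (simple_extension_subfield p0 pa).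
move=> y [[c _ <-]|->]; first by exists c%:P; rewrite map_polyC hornerC.
by exists 'X; rewrite map_polyX hornerX.
Qed.

(** The evaluation of polynomials at alpha is injective, hence extends to F(t). *)
Lemma transcendental_embedding : ~ is_constant iota alpha ->
  exists phi : {rmorphism {fraction {poly F}} -> L},
    nonconstant_morphism iota K phi /\ phi (tofrac 'X) = alpha.
Proof.
move=> alphaN; pose h := horner_eval alpha \o map_poly (const iota).
have hinj : injective h.
  apply: raddf_inj => p hp; apply/eqP; apply: contra_notT alphaN => p0.
  by exists p => //; apply/rootP.
have [phi phiE] := fraction_lift hinj.
have phic c : phi (tofrac c%:P) = const iota c.
  by rewrite phiE /h /= map_polyC /horner_eval hornerC.
have phiX : phi (tofrac 'X) = alpha.
  by rewrite phiE /h /= map_polyX /horner_eval hornerX.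
exists phi; split=> //; split=> // _ [x _ <-].
have [[p q] /= [q0 ->]] := fractionP x; rewrite fmorph_div !phiE /=.
have subK := adjoin_subfield.
apply: (subfield_div subK); apply: (subfield_horner subK);
  by [apply: adjoin_generator|move=> c; apply: adjoin_rational].
Qed.

(** Both F(T)(alpha) and F(alpha)(T) are the field generated over F by T and
    alpha. *)
Lemma adjoin_swap (phi : {rmorphism {fraction {poly F}} -> L}) p :
  (forall c, phi (tofrac c%:P) = const iota c) -> phi (tofrac 'X) = alpha ->
  p != 0 -> (map_poly phi p).[iota (tofrac 'X)] = 0 ->
  forall x, K x -> exists g, x = (map_poly phi g).[iota (tofrac 'X)].
Proof.
move=> phic phiX p0 pT x; set T := iota (tofrac 'X).
have subS := simple_extension_subfield p0 pT.
move=> /(_ [set y | exists g, y = (map_poly phi g).[T]]); apply.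
split=> // y [[r _ <-]|->]; last first.
  by exists (tofrac 'X)%:P; rewrite map_polyC hornerC.
have polyS (u : {poly F}) : exists g, iota (tofrac u) = (map_poly phi g).[T].
  exists (map_poly (@tofrac _ \o polyC) u); rewrite -map_poly_comp.
  rewrite (eq_map_poly (g := const iota)); last by move=> c; rewrite /= phic.
  elim/poly_ind: u => [|u c IH]; first by rewrite !rmorph0 horner0.
  by rewrite !rmorphD !rmorphM /= map_polyX map_polyC !hornerE IH.
have [[u v] /= [v0 ->]] := fractionP r; rewrite fmorph_div.
exact: (subfield_div subS (polyS u) (polyS v)).
Qed.

End Adjoin.

(** * Orders of Laurent series *)

Section Laurent.
Variable F : fieldType.
Implicit Types (f g : laurent F) (N M : int).
Local Notation X := (laurent_of_poly ('X : {poly F})).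

Lemma lcoefD f g i : lcoef (f + g) i = lcoef f i + lcoef g i.
Proof. by []. Qed.

Lemma lcoefN f i : lcoef (- f) i = - lcoef f i.
Proof. by []. Qed.

Lemma lcoef_sum (I : Type) (r : seq I) (P : pred I) (f : I -> laurent F) i :
  lcoef (\sum_(j <- r | P j) f j) i = \sum_(j <- r | P j) lcoef (f j) i.
Proof. by apply: (big_morph (fun f => lcoef f i)). Qed.

Lemma lboundedB N f g : lbounded N f -> lbounded N g -> lbounded N (f - g).
Proof. by move=> fN gN i iN; rewrite lcoefD lcoefN fN // gN // subr0. Qed.

Lemma lboundedM N M f g :
  lbounded N f -> lbounded M g -> lbounded (N + M) (f * g).
Proof. exact: lconv_small. Qed.

Lemma lbounded1 : lbounded 0 (1 : laurent F).
Proof. by move=> i; rewrite /= => i0; rewrite lt_eqF. Qed.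

Lemma lcoefM_lead N M f g : lbounded N f -> lbounded M g ->
  lcoef (f * g) (N + M) = lcoef f N * lcoef g M.
Proof.
move=> fN gM; have := lconvE 0%N fN gM.
by rewrite addr0 big_ord1 !addr0 => <-.
Qed.

Lemma lbounded_succ N f : lbounded N f -> lcoef f N = 0 -> lbounded (N + 1) f.
Proof.
move=> fN f0 i iN; have [->//|iN'] := eqVneq i N.
by apply: fN; rewrite lt_neqAle iN' -ltzD1.
Qed.

Lemma lboundedX N f n : lbounded N f ->
  lbounded (n%:Z * N) (f ^+ n) /\ lcoef (f ^+ n) (n%:Z * N) = lcoef f N ^+ n.
Proof.
move=> fN; elim: n => [|n [IHb IHc]].
  by rewrite mul0r; split=> //; apply: lbounded1.
rewrite intS mulrDl mul1r !exprS; split; first exact: lboundedM.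
by rewrite lcoefM_lead // IHc.
Qed.

Lemma lboundedV N f : lbounded N f -> lcoef f N != 0 -> lbounded (- N) f^-1.
Proof.
move=> fN fN0; have f0 : f != 0 by apply: contraNneq fN0 => ->.
have [M [gM0 gM]] := lorder_exists (invr_neq0 f0).
have := lcoefM_lead fN gM; rewrite mulfV //=.
by case: eqP => [/addr0_eq -> //|_ /esym/eqP]; rewrite mulf_eq0 (negPf fN0) (negPf gM0).
Qed.

Lemma lbounded_laurentX : lbounded 1 X.
Proof. by case=> [[|n]|n] //= _; rewrite coefX. Qed.

Lemma lcoefXM f i : lcoef (X * f) (i + 1) = lcoef f i.
Proof.
have [M fM] := lboundedP f; have [iM|Mi] := ltP i M.
  by rewrite fM // (lboundedM lbounded_laurentX fM) //; lia.
rewrite (_ : i + 1 = 1 + M + `|i - M|%N%:Z); last by lia.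
have /= -> := lconvE `|i - M|%N lbounded_laurentX fM.
rewrite big_ord_recl big1 ?addr0 /=; last by move=> j _; rewrite coefX mul0r.
by rewrite coefX mul1r subn0; congr lcoef; lia.
Qed.

Lemma lcoefXnM f n i : lcoef (X ^+ n * f) i = lcoef f (i - n%:Z).
Proof.
elim: n i => [|n IH] i; first by rewrite mul1r subr0.
by rewrite exprS -mulrA -[i](subrK 1) lcoefXM IH; congr lcoef; lia.
Qed.

Lemma laurentX_neq0 : X != 0.
Proof.
by apply/eqP => /(congr1 (fun f => lcoef f 1)) /= /eqP; rewrite coefX oner_eq0.
Qed.

Lemma laurent_of_poly_inj : injective (@laurent_of_poly F).
Proof.
move=> p q pq; apply/polyP => n.
by have /= := congr1 (fun f => lcoef f n) pq.
Qed.

(** The terms have orders in distinct classes modulo p, so the term of least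
    order cannot cancel. *)
Lemma laurent_power_independent p (s : 'I_p -> laurent F) :
  \sum_(j < p) X ^+ j * s j ^+ p = 0 -> forall j, s j = 0.
Proof.
move=> s0 j1; apply/eqP; apply: contraT => sj1.
have /choice[v vP] : forall j, exists v : int, s j != 0 ->
    lcoef (s j) v != 0 /\ lbounded v (s j).
  by move=> j; have [_|/lorder_exists[v]] := eqVneq (s j) 0; [exists 0|exists v].
pose w (j : 'I_p) : int := j%:Z + p%:Z * v j.
pose j0 := [arg min_(j < j1 | s j != 0) w j]%O.
have [sj0 w0] : s j0 != 0 /\ forall j, s j != 0 -> w j0 <= w j.
  by rewrite /j0; case: arg_minP.
have [sv0 sb0] := vP _ sj0; have [_ sp0] := lboundedX p sb0.
have : lcoef (\sum_(j < p) X ^+ j * s j ^+ p) (w j0) = 0 by rewrite s0.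
rewrite lcoef_sum (bigD1 j0) // big1 => [|j jj0].
  rewrite lcoefXnM (_ : w j0 - j0%:Z = p%:Z * v j0) ?sp0; last by rewrite /w; lia.
  by move/eqP; rewrite /= addr0 expf_eq0 (negPf sv0) andbF.
have [->|sj] := eqVneq (s j) 0.
  by rewrite lcoefXnM expr0n /= gtn_eqF ?(leq_ltn_trans _ (ltn_ord j)).
have [_ /(lboundedX p)[sb _]] := vP _ sj; rewrite lcoefXnM; apply: sb.
have : w j0 != w j.
  apply: contraNneq jj0 => ww; apply/eqP/val_inj.
  have := congr1 (fun x => (x %% p%:Z)%Z) ww.
  rewrite /w ![_ * v _]mulrC ![_%:Z + _]addrC !modzMDl !modz_nat !modn_small //.
  by case.
by have := w0 _ sj; rewrite /w; lia.
Qed.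

End Laurent.

(** * Roots in Laurent series are simple *)

Section PthRoots.
Variables (F : finFieldType) (p : nat) (pcharF : p \in [pchar F]).

Lemma finField_pth_root (c : F) : exists a, c = a ^+ p.
Proof.
have [g _ gK] := injF_bij (fmorph_inj (GRing.pFrobenius_aut pcharF)).
by exists (g c); rewrite -{1}[c]gK.
Qed.

(** As F is perfect, c T ^ n is T ^ (n mod p) times the p-th power of
    c ^ (1/p) T ^ (n / p). *)
Lemma poly_pth_decomposition (a : {poly F}) :
  exists c : 'I_p -> {poly F}, a = \sum_(j < p) 'X^j * c j ^+ p.
Proof.
have pP : p \in [pchar {poly F}] by apply: (rmorph_pchar polyC).
have p0 : (0 < p)%N by apply/prime_gt0/(pcharf_prime pcharF).
rewrite -[a]coefK poly_def.
apply: (big_ind (fun a => exists c : 'I_p -> {poly F},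
  a = \sum_(j < p) 'X^j * c j ^+ p)).
- exists (fun=> 0); rewrite big1 // => j _.
  by rewrite expr0n gtn_eqF // mulr0.
- move=> _ _ [c ->] [d ->]; exists (fun j => c j + d j); rewrite -big_split /=.
  apply: eq_bigr => j _; rewrite -mulrDr.
  by rewrite -!(pFrobenius_autE pP) rmorphD.
move=> i _; have [b bE] := finField_pth_root a`_i.
pose j0 := Ordinal (ltn_pmod i p0).
exists (fun j => if j == j0 then b%:P * 'X^(i %/ p) else 0).
rewrite (bigD1 j0) //= eqxx big1 ?addr0 => [|j /negPf ->].
  rewrite exprMn -exprM mulrCA -exprD addnC -divn_eq -rmorphXn -bE.
  by rewrite mul_polyC.
by rewrite expr0n gtn_eqF // mulr0.
Qed.

(** A fraction a / b is a b ^ (p - 1) divided by a p-th power. *)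
Lemma fraction_pth_decomposition (x : {fraction {poly F}}) :
  exists c : 'I_p -> {fraction {poly F}}, x = \sum_(j < p) tofrac 'X ^+ j * c j ^+ p.
Proof.
have p0 : (0 < p)%N by apply/prime_gt0/(pcharf_prime pcharF).
have [[a b] /= [b0 ->]] := fractionP x.
have [c cE] := poly_pth_decomposition (a * b ^+ p.-1).
exists (fun j => tofrac (c j) / tofrac b).
have b0' : tofrac b != 0 by rewrite tofrac_eq0.
apply: (mulIf (expf_neq0 p b0')); rewrite -{1}(prednK p0) exprS mulrA divfK //.
rewrite -tofracXn -tofracM cE rmorph_sum mulr_suml; apply: eq_bigr => j _.
by rewrite expr_div_n -mulrA divfK ?expf_neq0 // rmorphM !rmorphXn.
Qed.

End PthRoots.

Section Separability.
Variable F : finFieldType.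
Variable sigma : {rmorphism {fraction {poly F}} -> laurent F}.
Hypothesis sigmaX : sigma (tofrac 'X) = laurent_of_poly 'X.

(** F((T)) is separable over F(T): if f were a polynomial in x ^ p, writing its
    coefficients as sums of T ^ j c ^ p would turn a root of f into a root of
    polynomials of degree deg f / p. *)
Lemma irreducible_separable (f : {poly {fraction {poly F}}}) (r : laurent F) :
  irreducible_poly f -> (map_poly sigma f).[r] = 0 -> separable_poly f.
Proof.
move=> firr fr; have [f1 _] := firr; have f0 := irreducible_neq0 firr.
have sf0 : (0 < size f)%N by rewrite size_poly_gt0.
rewrite separable_poly.unlock.
rewrite irreducible_poly_coprime //.
have [f'0|f'0] := eqVneq f^`() 0; last first.
  by apply/negP => /(dvdp_leq f'0); rewrite leqNgt lt_size_deriv.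
have [p p_prime pF] := finPcharP F; have p0 := prime_gt0 p_prime.
have pE : p \in [pchar {fraction {poly F}}].
  exact: (rmorph_pchar (@tofrac {poly F} \o polyC)).
have pL : p \in [pchar laurent F] by apply: (rmorph_pchar sigma).
(* f is a polynomial in x ^ p, whose degree in x ^ p is n - 1 *)
pose n := ((size f).-1 %/ p).+1.
have fE : f = \poly_(i < n) f`_(i * p) \Po 'X^p.
  apply/polyP => i; rewrite coef_comp_poly_Xn //; case: ifP => pi.
    rewrite coef_poly divnK //; case: ifP => // /negbT; rewrite -leqNgt => ni.
    apply/eqP; apply: contraTT ni => fi; rewrite -ltnNge ltnS leq_div2r //.
    rewrite -ltnS prednK // ltnNge; apply: contra fi => sfi.
    by rewrite nth_default.
  case: i pi => [|i pi]; first by rewrite dvdn0.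
  have /eqP := congr1 (fun g : {poly _} => g`_i) f'0.
  rewrite coef_deriv coef0 -mulr_natr mulf_eq0 -(dvdn_pcharf pE) pi orbF.
  by move/eqP.
have /choice[c cE] i := fraction_pth_decomposition pF f`_(i * p).
pose g j := \poly_(i < n) c i j.
have gr0 : forall j, (map_poly sigma (g j)).[r] = 0.
  apply: laurent_power_independent; rewrite -[RHS]fr fE map_comp_poly horner_comp.
  rewrite map_polyXn hornerXn.
  have pw : (size (map_poly sigma (\poly_(i < n) f`_(i * p))%R) <= n)%N.
    by rewrite size_map_poly size_poly.
  rewrite (horner_coef_wide _ pw); symmetry.
  transitivity (\sum_(i < n) \sum_(j < p)
      laurent_of_poly 'X ^+ j * (sigma (c i j) * r ^+ i) ^+ p).
    apply: eq_bigr => i _; rewrite coef_map coef_poly ltn_ord /= cE rmorph_sum.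
    rewrite mulr_suml; apply: eq_bigr => j _.
    by rewrite rmorphM !rmorphXn /= sigmaX exprMn -mulrA -!exprM [(p * i)%N]mulnC.
  rewrite exchange_big; apply: eq_bigr => j _ /=; rewrite -mulr_sumr.
  congr (_ * _); have gw : (size (map_poly sigma (g j)) <= n)%N.
    by rewrite size_map_poly size_poly.
  rewrite (horner_coef_wide _ gw) -(pFrobenius_autE pL) rmorph_sum.
  by apply: eq_bigr => i _; rewrite /= coef_map coef_poly ltn_ord pFrobenius_autE.
have g0 j : g j = 0.
  apply/eqP; apply: contraT => gj.
  have := dvdp_leq gj (irreducible_dvd_root firr fr (gr0 j)).
  rewrite leqNgt (leq_ltn_trans (size_poly _ _)) // /n.
  have sf1 : (0 < (size f).-1)%N by rewrite -ltnS prednK.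
  by rewrite -[ltnRHS](prednK sf0) ltnS ltn_Pdiv // prime_gt1.
case/eqP: f0; rewrite fE (_ : \poly_(i < n) _ = 0) ?comp_poly0 //.
apply/polyP => i; rewrite coef_poly coef0; case: ifP => // iN.
rewrite cE big1 // => j _; have /(congr1 (fun h : {poly _} => h`_i)) := g0 j.
by rewrite coef_poly iN coef0 => ->; rewrite expr0n gtn_eqF // mulr0.
Qed.

Lemma irreducible_roots_uniq (f : {poly {fraction {poly F}}}) rs :
  irreducible_poly f ->
  map_poly sigma f = lead_coef (map_poly sigma f) *: \prod_(r <- rs) ('X - r%:P) ->
  uniq rs.
Proof.
move=> firr fE; case: rs fE => [|r rs] // fE; set s := r :: rs in fE *.
have f0 := irreducible_neq0 firr.
have fr : (map_poly sigma f).[r] = 0.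
  by rewrite fE hornerZ /s big_cons hornerM hornerXsubC subrr mul0r mulr0.
have := irreducible_separable firr fr.
rewrite -(separable_map sigma) fE -separable_prod_XsubC.
by rewrite (eqp_separable (eqp_scale _ _)) // lead_coef_eq0 map_poly_eq0.
Qed.

End Separability.

(** * Rational points from Laurent series roots *)

Section RootPlaces.
Variables (F : finFieldType) (L : closedFieldType).
Variable iota : {rmorphism {fraction {poly F}} -> L}.
Variable alpha : L.
Variable sigma : {rmorphism {fraction {poly F}} -> laurent F}.
Hypothesis sigmaE : forall p, sigma (tofrac p) = laurent_of_poly p.
Variable f : {poly {fraction {poly F}}}.
Hypothesis f_irr : irreducible_poly f.
Hypothesis f_alpha : (map_poly iota f).[alpha] = 0.
Local Notation K := (adjoin iota alpha).
Local Notation T := (iota (tofrac 'X)).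

Let f_neq0 : f != 0 := irreducible_neq0 f_irr.

Lemma adjoinP x : K x <-> exists g, x = (map_poly iota g).[alpha].
Proof.
split; first exact: adjoin_simple f_neq0 f_alpha x.
move=> [g ->]; apply: (subfield_horner (adjoin_subfield _ _)).
  exact: adjoin_rational.
exact: adjoin_generator.
Qed.

Section OneRoot.
Variable r : laurent F.
Hypothesis f_r : (map_poly sigma f).[r] = 0.

(** The embedding of F(T)(alpha) in F((T)) over F(T) that sends alpha to r. It maps
    g(alpha) to g(r); the choice of g does not matter, because f divides the
    difference of two choices. *)
Definition root_embedding (x : L) : laurent F :=
  (map_poly sigma (xget 0 [set g | x = (map_poly iota g).[alpha]])).[r].
Local Notation tau := root_embedding.

Lemma root_embeddingE g : tau (map_poly iota g).[alpha] = (map_poly sigma g).[r].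
Proof.
rewrite /tau; case: xgetP => [h _ /= hE|/(_ g)[]//].
apply/eqP; rewrite -subr_eq0 -hornerN -hornerD -rmorphB.
have /dvdpP[u ->] : f %| h - g.
  apply: (irreducible_dvd_root f_irr f_alpha).
  by rewrite rmorphB hornerD hornerN /= -hE subrr.
by rewrite rmorphM hornerM /= f_r mulr0.
Qed.

Lemma root_embeddingB x y : K x -> K y -> tau (x - y) = tau x - tau y.
Proof.
move=> /adjoinP[g ->] /adjoinP[h ->].
by rewrite -hornerN -hornerD -rmorphB !root_embeddingE rmorphB hornerD hornerN.
Qed.

Lemma root_embeddingM x y : K x -> K y -> tau (x * y) = tau x * tau y.
Proof.
move=> /adjoinP[g ->] /adjoinP[h ->].
by rewrite -hornerM -rmorphM !root_embeddingE rmorphM hornerM.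
Qed.

Lemma root_embedding_rational c : tau (iota c) = sigma c.
Proof. by have := root_embeddingE c%:P; rewrite !map_polyC !hornerC. Qed.

Lemma root_embedding_generator : tau alpha = r.
Proof. by have := root_embeddingE 'X; rewrite !map_polyX !hornerX. Qed.

Lemma root_embeddingV x : K x -> tau x^-1 = (tau x)^-1.
Proof.
move=> Kx; have [->|x0] := eqVneq x 0.
  by rewrite invr0 -(rmorph0 iota) root_embedding_rational rmorph0 invr0.
have KV := subfieldV (adjoin_subfield iota alpha) Kx.
have := root_embeddingM Kx KV; rewrite mulfV // -(rmorph1 iota).
rewrite root_embedding_rational rmorph1 => e.
have t0 : tau x != 0.
  by apply: contra_eq_neq e => ->; rewrite mul0r oner_eq0.
by apply: (mulfI t0); rewrite -e mulfV.
Qed.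

Lemma root_embedding_const c :
  tau (const iota c) = laurent_of_poly c%:P.
Proof. by rewrite root_embedding_rational sigmaE. Qed.

Definition root_place : set L := [set x | K x /\ lbounded 0 (tau x)].

Lemma root_place_const c : root_place (const iota c).
Proof.
split; first exact: adjoin_rational.
by rewrite root_embedding_const; case.
Qed.

Lemma root_placeB x y : root_place x -> root_place y -> root_place (x - y).
Proof.
move=> [Kx xO] [Ky yO]; split; first exact: (subfieldB (adjoin_subfield _ _)).
by rewrite root_embeddingB //; apply: lboundedB.
Qed.

Lemma root_place_ideal x : root_place x ->
  lcoef (tau x) 0 = 0 -> maximal_ideal root_place x.
Proof.
move=> Ox x0; split=> //; have [->|xn0] := eqVneq x 0; [by left|right].
move=> [KV VO]; have [Kx xO] := Ox.
have := lboundedM (lbounded_succ xO x0) VO; rewrite -root_embeddingM // mulfV //.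
rewrite -(rmorph1 (const iota)) root_embedding_const rmorph1 => /(_ 0).
by rewrite /= => /(_ isT)/eqP; rewrite oner_eq0.
Qed.

Lemma root_place_value x : root_place x ->
  has_value iota root_place x (lcoef (tau x) 0).
Proof.
move=> Ox; have [Kx xO] := Ox; have Oc := root_place_const (lcoef (tau x) 0).
apply: root_place_ideal; first exact: root_placeB.
rewrite root_embeddingB //; last by case: Oc.
by rewrite lcoefD lcoefN root_embedding_const /= coefC subrr.
Qed.

(** A nonzero series or its inverse has nonnegative order, and its constant term is
    in F. The inverse of T shows that the ring is not the whole field. *)
Lemma root_place_rational : rational_points iota K root_place.
Proof.
split; last by move=> x Ox; exists (lcoef (tau x) 0); apply: root_place_value.
split.
- split=> [|x y|x y]; rewrite !inE.
  + by rewrite -(rmorph1 (const iota)); apply: root_place_const.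
  + exact: root_placeB.
  + move=> [Kx xO] [Ky yO]; split; first exact: (subfieldM (adjoin_subfield _ _)).
    by rewrite root_embeddingM // -(addr0 0); apply: lboundedM.
- by move=> _ [c _ <-]; apply: root_place_const.
- split; first by move=> x [].
  have KT : K T by apply: adjoin_rational.
  move=> /(_ T^-1)[|_]; first exact: (subfieldV (adjoin_subfield _ _)).
  rewrite root_embeddingV // root_embedding_rational sigmaE => XV.
  have := lboundedM (@lbounded_laurentX F) XV; rewrite mulfV ?laurentX_neq0 //.
  by move=> /(_ 0 isT) /= /eqP; rewrite oner_eq0.
move=> x Kx; have KV := subfieldV (adjoin_subfield iota alpha) Kx.
have [x0|x0] := eqVneq (tau x) 0; first by left; split=> //; rewrite x0.
have [v [xv0 xv]] := lorder_exists x0.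
have [v0|v0] := leP 0 v; [left|right]; split=> //.
  exact: lboundedW xv.
rewrite root_embeddingV //; apply: lboundedW (lboundedV xv xv0).
by rewrite oppr_ge0 ltW.
Qed.

Lemma root_place_idealP : maximal_ideal root_place alpha <-> lbounded 1 r.
Proof.
have OP := root_place_rational; have subK := adjoin_subfield iota alpha.
split=> [aI|rb].
  have Oa := ideal_point aI; have [_ aO] := Oa.
  have a0 : has_value iota root_place alpha 0 by apply/value_ideal.
  rewrite -root_embedding_generator; apply: lbounded_succ aO _.
  exact: (value_unique subK OP (root_place_value Oa) a0).
apply: root_place_ideal; rewrite ?root_embedding_generator; last exact: rb.
split; first exact: adjoin_generator.
by rewrite root_embedding_generator; apply: lboundedW rb.
Qed.

End OneRoot.

(** The expansion at r of a regular x is determined by the ring of the place: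
    its constant term is the value c of x, and (x - c) / T is again regular. *)
Lemma root_place_expansion r s : (map_poly sigma f).[r] = 0 ->
  (map_poly sigma f).[s] = 0 -> root_place r = root_place s ->
  forall n x, root_place r x ->
    lcoef (root_embedding r x) n%:Z = lcoef (root_embedding s x) n%:Z.
Proof.
move=> fr fs rs; have OP := root_place_rational fr.
have subK := adjoin_subfield iota alpha.
have step t n x c : (map_poly sigma f).[t] = 0 -> K x ->
    lcoef (root_embedding t x) n.+1%:Z =
    lcoef (root_embedding t ((x - const iota c) / T)) n%:Z.
  move=> ft Kx; have KT : K T by apply: adjoin_rational.
  have Kc : K (const iota c) by apply: adjoin_rational.
  have Kxc := subfieldB subK Kx Kc; have KV := subfieldV subK KT.
  rewrite root_embeddingM // root_embeddingV // root_embedding_rational //.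
  rewrite sigmaE root_embeddingB // root_embedding_const //.
  rewrite -(lcoefXM _ n%:Z) mulrC mulfVK ?laurentX_neq0 //.
  by rewrite -PoszD addn1 lcoefD lcoefN /= coefC subr0.
elim=> [|n IH] x Ox.
  apply: (value_unique subK OP (root_place_value fr Ox)).
  by rewrite rs in Ox *; apply: root_place_value.
have [Kx xO] := Ox; pose c := lcoef (root_embedding r x) 0.
rewrite (step r n x c) // (step s n x c) //; apply: IH.
have KT : K T by apply: adjoin_rational.
have [Oxc _] := root_place_value fr Ox; have [Kxc xcO] := Oxc.
split; first exact: (subfield_div subK).
move=> i i0; rewrite -lcoefXM root_embeddingM //; last exact: (subfieldV subK).
rewrite root_embeddingV // root_embedding_rational // sigmaE.
rewrite mulrC mulfVK ?laurentX_neq0 //.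
have [->|i1] := eqVneq i (-1); last by apply: xcO; lia.
rewrite root_embeddingB //; last exact: adjoin_rational.
by rewrite root_embedding_const // lcoefD lcoefN /= coefC subrr.
Qed.

(** A power of T makes alpha regular, and then r and s have the same expansion up
    to that power. *)
Lemma root_place_inj r s : (map_poly sigma f).[r] = 0 ->
  (map_poly sigma f).[s] = 0 -> root_place r = root_place s -> r = s.
Proof.
move=> fr fs rs; have subK := adjoin_subfield iota alpha.
have [N rN] := lboundedP r; pose k := `|N|%N; pose x := T ^+ k * alpha.
have KTk : K (T ^+ k) by apply: (subfieldX subK); apply: adjoin_rational.
have Ka : K alpha by apply: adjoin_generator.
have xE t : (map_poly sigma f).[t] = 0 ->
    root_embedding t x = laurent_of_poly 'X ^+ k * t.
  move=> ft; rewrite root_embeddingM // root_embedding_generator //.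
  by rewrite -rmorphXn root_embedding_rational // rmorphXn sigmaE.
have Ox : root_place r x.
  split; first exact: (subfieldM subK).
  by move=> i i0; rewrite xE // lcoefXnM; apply: rN; lia.
apply: (mulfI (expf_neq0 k (laurentX_neq0 F))); rewrite -!xE //.
apply: laurentP => -[n|n]; first exact: (root_place_expansion fr fs rs).
have [_ ->//] := Ox; rewrite rs in Ox.
by have [_ ->//] := Ox.
Qed.

End RootPlaces.

(** * Degree and gonality *)

Lemma card_uniq_seq (T : eqType) (s : seq T) : uniq s -> ([set` s] #= `I_(size s))%card.
Proof.
case: s => [|x s']; first by rewrite set_nil II0.
move: (x :: s') => s s_uniq.
have -> : [set` s] = nth x s @` `I_(size s).
  apply/seteqP; split=> [y /= ys|_ [i /= si <-]]; last exact: mem_nth.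
  by exists (index y s); rewrite ?nth_index //= index_mem.
apply: inj_card_eq => i j; rewrite !inE /= => si sj /eqP.
by rewrite nth_uniq // => /eqP.
Qed.

Lemma T_order_gt0 (F : fieldType) (f : laurent F) :
  (0 < T_order f)%E <-> lbounded 1 f.
Proof.
rewrite /T_order; have [->|f0] := eqVneq f 0; first by rewrite ltry.
case: xgetP => [v _ [fv vf]|nv]; last by have [v /nv] := lorder_exists f0.
rewrite lte_fin; split=> [v0|f1]; first by apply: lboundedW vf; rewrite -gtz0_ge1.
by rewrite ltNge; apply: contra_neqN fv => v0; apply: f1; apply: le_lt_trans v0 _.
Qed.

Section MinimalPolynomial.
Variables (F : finFieldType) (L : closedFieldType).
Variable iota : {rmorphism {fraction {poly F}} -> L}.
Variable alpha : L.
Local Notation K := (adjoin iota alpha).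
Local Notation T := (iota (tofrac 'X)).

(** The default value 0 of the minimal polynomial would give height 0. *)
Lemma height_neq0_minimal : height iota alpha != 0 ->
  is_minimal_polynomial iota alpha (minimal_polynomial iota alpha).
Proof.
rewrite /height /minimal_polynomial; case: xgetP => // _ /negP[].
by rewrite size_poly0 mulr0n invr0 mulr0 eqxx.
Qed.

(** The powers of alpha below the degree of f are a basis: they span because f
    vanishes at alpha, and a dependence would give a multiple of f of smaller
    degree. *)
Lemma extension_degree_irreducible (f : {poly {fraction {poly F}}}) d :
  irreducible_poly f -> (map_poly iota f).[alpha] = 0 ->
  extension_degree (rational_functions iota) K d -> d = (size f).-1.
Proof.
move=> f_irr fa Kd; have f0 := irreducible_neq0 f_irr.
have [b [bK bP]] := Kd; apply/eqP; rewrite eqn_leq; apply/andP; split; rewrite leqNgt.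
  apply/negP => fd; have [|v [[i vi] vb]] := linear_dependence
      (phi := iota) (b := fun i : 'I_(size f).-1 => alpha ^+ i) (e := b) fd.
    move=> i; have [g ->] := adjoin_simple f0 fa (bK i).
    exact: (simple_extension_span g f0 fa).
  have [c [_ c_uniq]] := bP 0 (subfield0 (adjoin_subfield iota alpha)).
  have c0 : c = [ffun=> 0].
    apply: c_uniq; split=> [j|]; first by rewrite ffunE; exists 0; rewrite ?rmorph0.
    by rewrite big1 // => j _; rewrite ffunE mul0r.
  have cv : c = [ffun j => iota (v j)].
    apply: c_uniq; split=> [j|]; first by rewrite ffunE; exists (v j).
    by rewrite -[LHS]vb; apply: eq_bigr => j _; rewrite ffunE.
  move: vi; rewrite -(fmorph_eq0 iota) => /eqP; apply.
  by have := congr1 (fun h : {ffun _ -> _} => h i) cv; rewrite c0 !ffunE.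
apply/negP => df; have [b' span] := degree_spanned Kd.
have [|v [[i vi] va]] := linear_dependence (phi := iota) (b := b')
    (e := fun i : 'I_(size f).-1 => alpha ^+ i) df.
  move=> i; apply: span; apply: (subfieldX (adjoin_subfield _ _)).
  exact: adjoin_generator.
have [g [g0 gf ga]] := power_relation vi va.
have := dvdp_leq g0 (irreducible_dvd_root f_irr fa ga).
by rewrite leqNgt (leq_ltn_trans gf) // prednK // size_poly_gt0.
Qed.

Lemma morphism_tofrac (phi : {rmorphism {fraction {poly F}} -> L}) u :
  (forall c, phi (tofrac c%:P) = const iota c) ->
  phi (tofrac u) = (map_poly (const iota) u).[phi (tofrac 'X)].
Proof.
move=> phic; elim/poly_ind: u => [|u c IH]; first by rewrite !rmorph0 horner0.
by rewrite !rmorphD !rmorphM /= map_polyX map_polyC phic IH !hornerE.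
Qed.

(** Both sides are the value of f at T and alpha. *)
Lemma swapped_relation (phi : {rmorphism {fraction {poly F}} -> L})
    (f : {poly {poly F}}) :
  (forall c, phi (tofrac c%:P) = const iota c) -> phi (tofrac 'X) = alpha ->
  (map_poly phi (over_rational (swapXY f))).[T] =
  (map_poly iota (over_rational f)).[alpha].
Proof.
move=> phic phiX; pose fL := map_poly (map_poly (const iota)) f.
have E (psi : {rmorphism {fraction {poly F}} -> L}) (g : {poly {poly F}}) :
    (forall c, psi (tofrac c%:P) = const iota c) ->
    map_poly psi (over_rational g) =
    map_poly (horner_eval (psi (tofrac 'X))) (map_poly (map_poly (const iota)) g).
  move=> psic; rewrite -!map_poly_comp; apply: eq_map_poly => u.
  exact: morphism_tofrac.
rewrite !E // phiX -swapXY_map -!horner_swapXY swapXYK.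
by rewrite horner2_swapXY.
Qed.

End MinimalPolynomial.

Section Main.
Variables (F : finFieldType) (L : closedFieldType).
Variable iota : {rmorphism {fraction {poly F}} -> L}.
Variable alpha : L.
Local Notation K := (adjoin iota alpha).
Local Notation T := (iota (tofrac 'X)).
Local Notation rational := (rational_points iota K).

Lemma spanned_by_powers (phi : {rmorphism {fraction {poly F}} -> L}) p :
  nonconstant_morphism iota K phi -> phi (tofrac 'X) = alpha ->
  p != 0 -> (map_poly phi p).[T] = 0 -> spanned_by K phi (size p).-1.
Proof.
move=> [phic _] phiX p0 pT; exists (fun i => T ^+ i) => x.
move=> /(adjoin_swap phic phiX p0 pT)[g ->].
exact: (simple_extension_span g p0 pT).
Qed.

(** A field with m (q + 1) rational points is not spanned over any F(t) by fewer
    than m elements, so no morphism has degree less than m. For the same reason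
    the m powers of T that span the field over F(alpha) are independent. *)
Lemma gonality_of_rational_points (phi : {rmorphism {fraction {poly F}} -> L})
    p m (s : seq (set L)) :
  nonconstant_morphism iota K phi -> phi (tofrac 'X) = alpha ->
  p != 0 -> (map_poly phi p).[T] = 0 -> size p = m.+1 ->
  uniq s -> (forall O, O \in s -> rational O) -> size s = (m * (#|F| + 1))%N ->
  is_gonality iota K m.
Proof.
move=> phiP phiX p0 pT pm s_uniq sP sm; have subK := adjoin_subfield iota alpha.
have lower psi k : nonconstant_morphism iota K psi -> spanned_by K psi k -> (m <= k)%N.
  move=> psiP /(rational_points_bound subK psiP)/(_ s_uniq sP)[+ _].
  by rewrite sm leq_pmul2r // addn1.
split; last by move=> psi k psiP /degree_spanned; apply: lower.
exists phi; split=> //; exists (fun i => T ^+ i); split=> [i|x Kx].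
  by apply: (subfieldX subK); apply: adjoin_rational.
have [phic _] := phiP.
have [g xE] := adjoin_swap phic phiX p0 pT Kx.
have [c cE] : exists c : 'I_m -> _, x = \sum_i phi (c i) * T ^+ i.
  by have := simple_extension_span g p0 pT; rewrite -xE pm.
exists [ffun i => phi (c i)]; split.
  split=> [i|]; first by rewrite ffunE; exists (c i).
  by rewrite cE; apply: eq_bigr => i _; rewrite ffunE.
move=> c' [c'phi xE']; have /choice[e eE] : forall i, exists z, c' i = phi z.
  by move=> i; case: (c'phi i) => z _ <-; exists z.
apply/ffunP => i; rewrite ffunE eE; congr (phi _); apply/eqP; rewrite -subr_eq0.
apply: contraT => cei.
have [|q [q0 qm qT]] := @power_relation _ _ phi T m (fun j => c j - e j) i cei.
  rewrite -[RHS](subrr x) {1}cE xE' -sumrB; apply: eq_bigr => j _.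
  by rewrite eE rmorphB mulrBl.
have := lower phi _ phiP (spanned_by_powers phiP phiX q0 qT).
by rewrite leqNgt prednK ?size_poly_gt0 // qm.
Qed.

End Main.

Theorem theoremB (F : finFieldType) (L : closedFieldType)
    (iota : {rmorphism {fraction {poly F}} -> L})
    (L_algebraic : forall x : L, algebraicOver iota x)
    (alpha : L) (d : nat) :
  totally_T_adic iota alpha ->
  ~ is_constant iota alpha ->
  extension_degree (rational_functions iota) (adjoin iota alpha) d ->
  height iota alpha = 1 / (#|F| + 1)%N%:R ->
  (rational_points iota (adjoin iota alpha) #= `I_d)%card /\
  exists n : nat,
    [/\ is_gonality iota (adjoin iota alpha) n,
        d = (n * (#|F| + 1))%N
      & ([set beta | conjugates iota alpha beta /\ (0 < T_order beta)%E]
           #= `I_n)%card].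
Proof.
move=> [rs rsE] alphaN Kd hE; set K := adjoin iota alpha in Kd *.
have subK : is_subfield K := adjoin_subfield iota alpha.
have q0 : (#|F| + 1)%N%:R != 0 :> rat by rewrite pnatr_eq0 addn1.
have [f_irr fa _ _] : is_minimal_polynomial iota alpha (minimal_polynomial iota alpha).
  by apply: height_neq0_minimal; rewrite hE mul1r invr_eq0.
move: rsE hE; rewrite /height /conjugates.
set f := minimal_polynomial iota alpha in f_irr fa *; set m := (sizeY f).-1 => rsE hE.
move/rootP: fa => fa.
have tofrac_inj : injective (@tofrac {poly F}).
  by apply: raddf_inj => x /eqP; rewrite tofrac_eq0 => /eqP.
have size_f : size (over_rational f) = size f.
  by apply: size_map_inj_poly; rewrite ?rmorph0.
have f_deg : (size f).-1 = (m * (#|F| + 1))%N.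
  have D0 : (size f).-1%:R != 0 :> rat.
    by apply: contra_eq_neq hE => ->; rewrite invr0 mulr0 mul1r eq_sym invr_eq0.
  by move/eqP: hE; rewrite eqr_div // mul1r -natrM eqr_nat => /eqP ->.
have dE : d = (m * (#|F| + 1))%N.
  by rewrite (extension_degree_irreducible f_irr fa Kd) size_f.
have [sigma sigmaE] := fraction_lift (@laurent_of_poly_inj F).
have fL : over_laurent f = map_poly sigma (over_rational f).
  by rewrite /over_laurent /over_rational -map_poly_comp; apply: eq_map_poly => p /=.
have rs_uniq : uniq rs.
  by apply: (irreducible_roots_uniq (sigmaE 'X) f_irr); rewrite -fL.
have fL0 : lead_coef (over_laurent f) != 0.
  by rewrite lead_coef_eq0 fL map_poly_eq0 irreducible_neq0.
have rs_root r : r \in rs = root (over_laurent f) r.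
  by rewrite rsE rootZ // root_prod_XsubC.
have fr r : r \in rs -> (map_poly sigma (over_rational f)).[r] = 0.
  by rewrite rs_root fL => /rootP.
have rs_size : size rs = d.
  rewrite dE -f_deg -size_f -(size_map_poly sigma) -fL rsE.
  by rewrite size_scale // size_prod_XsubC.
pose place := root_place iota alpha sigma.
pose s := [seq place r | r <- rs].
have s_uniq : uniq s.
  rewrite map_inj_in_uniq // => r1 r2 /fr fr1 /fr fr2.
  exact: (root_place_inj sigmaE f_irr fa).
have sP O : O \in s -> rational_points iota K O.
  by move=> /mapP[r /fr frr ->]; apply: (root_place_rational sigmaE f_irr fa frr).
have s_size : size s = (m * (#|F| + 1))%N by rewrite size_map rs_size dE.
have [phi [phiP phiX]] := transcendental_embedding alphaN.
pose p := over_rational (swapXY f).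
have pm : size p = m.+1.
  rewrite size_map_inj_poly ?rmorph0 // -sizeYE prednK // lt0n sizeY_eq0.
  by rewrite -size_poly_eq0 -size_f size_poly_eq0 irreducible_neq0.
have p0 : p != 0 by rewrite -size_poly_eq0 pm.
have pT : (map_poly phi p).[iota (tofrac 'X)] = 0.
  by rewrite (swapped_relation f phiP.1 phiX).
have Km : spanned_by K phi m.
  by have := spanned_by_powers phiP phiX p0 pT; rewrite pm.
have bound := rational_points_bound subK phiP Km.
split.
  (* a further rational point would exceed the bound *)
  have -> : rational_points iota K = [set` s].
    apply/seteqP; split=> O; last exact: sP.
    move=> OP /=; apply: contraT => Os; have [|O'|] := bound (O :: s).
    - by rewrite /= Os.
    - by rewrite inE => /orP[/eqP ->|/sP].
    by rewrite /= s_size ltnn.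
  by rewrite dE -s_size; apply: card_uniq_seq.
exists m; split=> //.
  exact: (gonality_of_rational_points phiP phiX p0 pT pm s_uniq sP s_size).
(* equality in the bound: each fibre of alpha, in particular that of 0, has m points *)
have [_ /esym] := bound s s_uniq sP.
rewrite s_size eqxx => /forallP/(_ (Some 0))/eqP <-.
have place0 r : r \in rs ->
    (reduction iota phi (place r) == Some 0) = `[< lbounded 1 r >].
  move=> /fr frr; have OP := root_place_rational sigmaE f_irr fa frr.
  have aP := root_place_idealP sigmaE f_irr fa frr.
  apply/eqP/asboolP => [r0|/aP aI].
    by have := reductionP phi OP; rewrite r0 /= phiX => /value_ideal/aP.
  by apply: (reduction_unique subK OP); rewrite phiX; apply/value_ideal.
rewrite count_map (eq_in_count place0) -size_filter.
rewrite (_ : [set beta | _] = [set` [seq r <- rs | `[< lbounded 1 r >]]]).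
  by apply: card_uniq_seq; apply: filter_uniq.
apply/seteqP; split=> r /=; rewrite mem_filter rs_root.
  by move=> [-> /T_order_gt0 r1]; rewrite andbT; apply/asboolP.
by move=> /andP[/asboolP r1 ->]; split=> //; apply/T_order_gt0.
Qed.
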